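(* Let $\mathbb{F}$ be any field and let $L$ be a nilpotent symplectic alternating algebra over $\mathbb{F}$ of dimension $10$ with an isotropic center of dimension $2$ that is of class $7$ and has the further properties that $L^4L^3\neq L^7$, $L^5L^2\leq L^4L^3$ and $UL^2$ is $2$-dimensional, where $U=\{x\in L^4:\ xL^3\leq L^5L^2\}$. Then $L$ can be given by a presentation of the form $$\mathcal{P}_{10}^{(2,6)}(r):\quad (x_2y_3,y_5)=r,\ (x_3y_4,y_5)=1,\ (x_1y_2,y_5)=1,\ (x_1y_3,y_4)=1,\ (y_1y_2,y_3)=1,$$ where $r\in\mathbb{F}$, $r\neq 0$. Furthermore two such presentations $\mathcal{P}_{10}^{(2,6)}(r)$ and $\mathcal{P}_{10}^{(2,6)}(s)$ describe the same algebra if and only if $s/r\in(\mathbb{F}^* )^{12}$.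
   Context: A symplectic alternating algebra (SAA) over a field $\mathbb{F}$ is a finite-dimensional vector space $L$ over $\mathbb{F}$ with a non-degenerate alternating bilinear form $(\ ,\ )$ and a bilinear product $\cdot$ satisfying $u\cdot u=0$ for all $u$ and $(u\cdot v,w)=(v\cdot w,u)$ for all $u,v,w\in L$. No associativity or Jacobi identity is assumed. The map $(u,v,w)\mapsto(uv,w)$ is then an alternating trilinear form. A standard basis (in dimension $10$) is a basis $x_1,y_1,\ldots,x_5,y_5$ with $(x_i,x_j)=(y_i,y_j)=0$ and $(x_i,y_j)=\delta_{ij}$ for all $i,j$. Presentations: $L$ is given by a presentation if there is a standard basis for which the listed values of triples $(uv,w)$ hold and $(uv,w)=0$ for all triples of basis elements that are not a reordering of a listed one. Two presentations describe the same algebra if the corresponding $10$-dimensional SAA's are isomorphic (by a linear bijection preserving product and form). $\mathbb{F}^*=\mathbb{F}\setminus\{0\}$, $(\mathbb{F}^* )^{12}=\{a^{12}:a\in\mathbb{F}^*\}$. For subspaces $U,V$, $UV$ is the span of all products $uv$. $L^1=L$, $L^{m+1}=L^mL$. $L$ is nilpotent if $L^{m+1}=\{0\}$ for some $m\ge 0$, and the smallest such $m$ is its (nilpotence) class. The center is $Z(L)=\{x\in L:xL=\{0\}\}$; it is isotropic if $(u,v)=0$ for all $u,v\in Z(L)$. (For $L$ of dimension $10$ and class $7$, $L^5L^2$ is a one-dimensional ideal contained in $L^7=Z(L)$.) *)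

(* Defs.v *)
From mathcomp Require Import all_boot all_order all_algebra.

Set Implicit Arguments.
Unset Strict Implicit.
Unset Printing Implicit Defensive.

Import GRing.Theory.
Local Open Scope ring_scope.

Record saa (F : fieldType) := Saa {
  saa_sort :> vectType F;
  saa_form : {biscalar saa_sort};
  saa_mul : {bilinear saa_sort -> saa_sort -> saa_sort};
  saa_formxx : forall u, saa_form u u = 0;
  saa_nondeg : forall u, (forall v, saa_form u v = 0) -> u = 0;
  saa_mulxx : forall u, saa_mul u u = 0;
  saa_formC : forall u v w,
    saa_form (saa_mul u v) w = saa_form (saa_mul v w) u }.

Declare Scope saa_scope.
Delimit Scope saa_scope with saa.
Notation "(| u , v |)" := (saa_form _ u v)
  (at level 0, u at level 99, v at level 99, format "(| u ,  v |)") : saa_scope.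
Notation "u ** v" := (saa_mul _ u v)
  (at level 40, left associativity) : saa_scope.
Local Open Scope saa_scope.

Section Subspaces.
Variables (F : fieldType) (L : saa F).
Implicit Types (U V W A : {vspace L}) (u v x : L).

(* By bilinearity, products of basis vectors span all products
   (see mul_vs_subP). *)
Definition mul_vs U V : {vspace L} :=
  <<[seq u ** v | u <- vbasis U, v <- vbasis V]>>%VS.

Lemma mul_vs_subP U V W :
  reflect {in U & V, forall u v, u ** v \in W} (mul_vs U V <= W)%VS.
Proof.
apply: (iffP span_subvP) => [sW u v uU vV | UVW w /allpairsP[[u v] /= [uU vV ->]]].
  rewrite (coord_vbasis uU) (coord_vbasis vV) linear_sumlz rpred_sum// => i _.
  rewrite linear_sumr rpred_sum//= => j _.
  rewrite linearZl_LR linearZr rpredZ// rpredZ//.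
  by rewrite sW// allpairs_f// mem_nth// size_tuple.
by apply: UVW; apply: vbasis_mem.
Qed.

(* {x in V | x A <= W}; see mem_transp. *)
Definition transp V A W : {vspace L} :=
  (V :&: \bigcap_(i < \dim A)
           (linfun (applyr (saa_mul L) (vbasis A)`_i) @^-1: W))%VS.

Lemma mem_transp V A W x :
  (x \in transp V A W) = (x \in V) && (mul_vs <[x]> A <= W)%VS.
Proof.
rewrite memv_cap; congr (_ && _).
have memPre i : (x \in (linfun (applyr (saa_mul L) (vbasis A)`_i) @^-1: W)%VS)
    = (x ** (vbasis A)`_i \in W) by rewrite -memv_preim lfunE.
rewrite memvE; apply/subv_bigcapP/mul_vs_subP => [xA _ a /vlineP[k ->] aA | xA i _].
  rewrite linearZl_LR rpredZ// (coord_vbasis aA) linear_sumr rpred_sum// => i _.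
  by rewrite linearZr_LR rpredZ// -memPre memvE xA.
rewrite -memvE memPre xA ?memv_line//.
by rewrite vbasis_mem// mem_nth// size_tuple.
Qed.

(* lcs m is L^m for m >= 1: lcs 1 = L and lcs m.+1 = (lcs m) L; the value at 0
   is L as well and is never used. *)
Definition lcs m : {vspace L} := iter m.-1 (fun U => mul_vs U fullv) fullv.

Definition nilpotent := exists m, lcs m.+1 = 0%VS.

Definition has_class c :=
  lcs c.+1 = 0%VS /\ forall m, lcs m.+1 = 0%VS -> (c <= m)%N.

Definition center : {vspace L} := transp fullv fullv 0%VS.

Definition isotropic U := {in U &, forall u v, (|u, v|) = 0}.

End Subspaces.

Arguments lcs {F} L m.
Arguments nilpotent {F} L.
Arguments has_class {F} L c.
Arguments center {F} L.

Definition saa_isom (F : fieldType) (A B : saa F) :=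
  exists f : {linear A -> B},
    [/\ bijective f,
        forall u v, (|f u, f v|) = (|u, v|) &
        forall u v, f (u ** v) = f u ** f v].

(* Labels of the elements of a standard basis in dimension 10: 'x_k and 'y_k
   for k = 1, ..., 5, the ordinals being shifted by one. *)
Definition gen := ('I_5 + 'I_5)%type.
Notation "''x_' k" := (inl (@Ordinal 5 k.-1 isT) : gen)
  (at level 8, k at level 2, format "''x_' k") : saa_scope.
Notation "''y_' k" := (inr (@Ordinal 5 k.-1 isT) : gen)
  (at level 8, k at level 2, format "''y_' k") : saa_scope.

Definition standard_basis (F : fieldType) (L : saa F) (e : gen -> L) :=
  [/\ basis_of fullv (codom e),
      forall i j, (|e (inl i), e (inl j)|) = 0,
      forall i j, (|e (inr i), e (inr j)|) = 0 &
      forall i j, (|e (inl i), e (inr j)|) = (i == j)%:R].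

(* An entry (a, b, c, t) stands for the relation (ab, c) = t. *)
Definition presentation (F : fieldType) := seq (gen * gen * gen * F).

Definition given_by (F : fieldType) (L : saa F) (P : presentation F) :=
  exists e : gen -> L,
    [/\ standard_basis e,
        forall a b c t, (a, b, c, t) \in P -> (|e a ** e b, e c|) = t &
        forall a b c,
          (forall a' b' c' t, (a', b', c', t) \in P ->
             ~~ perm_eq [:: a; b; c] [:: a'; b'; c']) ->
          (|e a ** e b, e c|) = 0].

Definition P10_2_6 (F : fieldType) (r : F) : presentation F :=
  [:: ('x_2, 'y_3, 'y_5, r); ('x_3, 'y_4, 'y_5, 1); ('x_1, 'y_2, 'y_5, 1);
      ('x_1, 'y_3, 'y_4, 1); ('y_1, 'y_2, 'y_3, 1)].

(* Main.v *)
Require Import Defs.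
From HB Require Import structures.
From mathcomp Require Import all_boot all_order all_algebra.
From mathcomp Require Import zify ring.

Import GRing.Theory.
Local Open Scope ring_scope.

(** Write (u, v) for the form.  Since (uv, w) = (u, wv), the centre is the
    orthogonal of L^2, and in class 7 the terms L^i and L^j are orthogonal as
    soon as i + j >= 9, and multiply to zero as soon as i + j >= 8.  With a
    centre of dimension 2 this leaves only the dimensions 10, 8, 7, 6, 4, 3, 2
    for L^1, ..., L^7 ([dim_lcs4] is the delicate one), so that L^i and L^(9-i)
    are orthogonals of each other.

    Existence.  Choose y_2 in L^3 outside L^4.  The line L^5 L^2 is spanned by
    some x_5 in L^4 L^3 = L^4 y_2, say x_5 = x_1 y_2; pick y_1 in L^4 with
    (x_1, y_1) = 1 and put x_3 = y_1 y_2.  As L^4 L^3 is not L^7, x_3 is not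
    central.  Gram-Schmidt completes these vectors, together with x_2 in L^5 and
    x_4 in L^7, to a standard basis running through the lower central series
    ([flag_low], [flag_basis_exists]).  Orthogonality then leaves only fifteen
    triples of labels on which (uv, w) can be nonzero ([flag_supported]), and it
    is nonzero on the five triples of the presentation ([flag_neq0]; the
    hypothesis on U L^2 gives (x_1 y_3, y_4) <> 0).  The other ten values are
    removed one at a time: a symplectic transvection adds to one of them a
    multiple of one of the five pivots and disturbs nothing that has to stay
    ([kill], [kill_all]).  Finally the diagonal torus turns four of the pivots
    into 1 ([normalize]); the value left over is r.

    Isomorphism.  In a basis realizing the presentation, the upper central series
    consists of coordinate subspaces ([ucs_level]).  Hence the transition matrix
    between two such bases of one algebra is block triangular, with three blocks
    of size 2, and these are triangular as well because the products x_2 y_3 and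
    x_1 y_2 are multiples of x_5 ([coor_low]).  The five pivots therefore see
    only the diagonal ([diag_table]).  The four pivots equal to 1 confine the
    diagonal to a one-parameter torus, on which r is multiplied by twelfth powers
    ([torus_ratio]).  Conversely every twelfth power is attained by a rescaling,
    and algebras with the same structure constants are isomorphic
    ([normal_isom]). *)

Set Implicit Arguments.
Unset Strict Implicit.
Unset Printing Implicit Defensive.
Local Open Scope saa_scope.

Local Notation triple := (gen * gen * gen)%type.

(** * Symplectic forms and orthogonal subspaces *)

Section Form.
Variables (F : fieldType) (L : saa F).
Implicit Types (U V W : {vspace L}) (u v w : L).

Lemma formNC u v : (|u, v|) = - (|v, u|).
Proof.
apply/eqP; rewrite -addr_eq0; apply/eqP.
have := saa_formxx (u + v).
by rewrite linearDl linearDr linearDr !saa_formxx add0r addr0.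
Qed.

Lemma mulNC u v : u ** v = - (v ** u).
Proof.
apply/eqP; rewrite -addr_eq0; apply/eqP.
have := saa_mulxx (u + v).
by rewrite linearDl linearDr linearDr !saa_mulxx add0r addr0.
Qed.

Lemma triC u v w : (|v ** u, w|) = - (|u ** v, w|).
Proof. by rewrite mulNC linearNl. Qed.

Lemma triC23 u v w : (|u ** w, v|) = - (|u ** v, w|).
Proof. by rewrite saa_formC triC -saa_formC. Qed.

(** Right multiplication by [v] is self-adjoint; every orthogonality below comes
    from moving a factor across the form in this way. *)
Lemma tri_form u v w : (|u ** v, w|) = (|u, w ** v|).
Proof. by rewrite saa_formC formNC mulNC linearNr opprK. Qed.

Lemma form0C u v : (|u, v|) = 0 -> (|v, u|) = 0.
Proof. by rewrite formNC => /eqP; rewrite oppr_eq0 => /eqP. Qed.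

Definition perp V : {vspace L} :=
  lker (linfun (fun u => \row_(i < \dim V) (|u, (vbasis V)`_i|))).

Lemma mem_perp V u :
  reflect (forall v, v \in V -> (|u, v|) = 0) (u \in perp V).
Proof.
rewrite memv_ker.
have -> : linfun (fun u => \row_(i < \dim V) (|u, (vbasis V)`_i|)) u
   = \row_(i < \dim V) (|u, (vbasis V)`_i|).
  have li : linear (fun u => \row_(i < \dim V) (|u, (vbasis V)`_i|)).
    by move=> k a b; apply/rowP=> i; rewrite !mxE linearPl.
  pose g := GRing.isLinear.Build _ _ _ _ _ li.
  pose h : {linear L -> 'rV_(\dim V)} :=
    HB.pack (fun u => \row_(i < \dim V) (|u, (vbasis V)`_i|)) g.
  exact: (lfunE h).
apply: (iffP eqP) => [/rowP uV v vV | uV]; last first.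
  apply/rowP=> i; rewrite !mxE uV// vbasis_mem// mem_nth// size_tuple//.
rewrite (coord_vbasis vV) linear_sumr big1// => i _.
by rewrite linearZr_LR/=; have := uV i; rewrite !mxE => ->; rewrite mulr0.
Qed.

Lemma perp_ge V : (\dim {:L} <= \dim (perp V) + \dim V)%N.
Proof.
set f := linfun (fun u => \row_(i < \dim V) (|u, (vbasis V)`_i|)).
rewrite -(limg_ker_dim f fullv) capfv leq_add2l.
have := dimvS (subvf (f @: fullv)).
by rewrite [\dim (fullv : {vspace 'rV__})]dimvf dim_matrix mul1r.
Qed.

(** [perp_ge] bounds both [perp V] and the orthogonal of a complement of [V] from
    below; as these two meet trivially, both bounds are attained. *)
Lemma dim_perp V : (\dim V + \dim (perp V) = \dim {:L})%N.
Proof.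
have C0 : (perp V :&: perp V^C = 0)%VS.
  apply/eqP; rewrite -subv0; apply/subvP => u; rewrite memv_cap memv0.
  move=> /andP[/mem_perp uV /mem_perp uC]; apply/eqP/saa_nondeg => v.
  have /memv_addP[a aV [b bC ->]] : v \in (V + V^C)%VS by rewrite addv_complf memvf.
  by rewrite linearDr uV ?uC ?addr0.
have := dimv_sum_cap (perp V) (perp V^C); rewrite C0 dimv0 addn0 => dd.
have := dimvS (subvf (perp V + perp V^C)); rewrite dd.
have := perp_ge V; have := perp_ge V^C; have := dimv_compl V.
have := dimvS (subvf V); lia.
Qed.

Lemma sub_perpC U V : (U <= perp V)%VS -> (V <= perp U)%VS.
Proof.
move=> /subvP UV; apply/subvP => v vV; apply/mem_perp => u /UV/mem_perp/(_ _ vV).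
exact: form0C.
Qed.
End Form.

(** * Standard bases and structure constants *)

Definition dual (g : gen) : gen :=
  match g with inl i => inr i | inr i => inl i end.

Lemma dualK : involutive dual. Proof. by case. Qed.

(** An explicit enumeration of the labels, so that statements on all labels can
    be decided by computation. *)
Definition gens : seq gen :=
  [:: 'x_1; 'x_2; 'x_3; 'x_4; 'x_5; 'y_1; 'y_2; 'y_3; 'y_4; 'y_5].

Lemma mem_gens g : g \in gens.
Proof. by case: g => [[[|[|[|[|[|i]]]]] ?]|[[|[|[|[|[|i]]]]] ?]]. Qed.

Definition permt (t t' : gen * gen * gen) :=
  perm_eq [:: t.1.1; t.1.2; t.2] [:: t'.1.1; t'.1.2; t'.2].

(** Alternating values depend on the order of a triple only up to sign, so
    lists of triples are read up to permutation. *)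
Definition listed (S : seq (gen * gen * gen)) t := has (permt t) S.

Section Basis.
Variables (F : fieldType) (L : saa F).
Implicit Types (u v w : L) (e : gen -> L).

Definition coor e (g : gen) u : F :=
  match g with inl i => (|u, e (inr i)|) | inr i => (|e (inl i), u|) end.

Definition tri e (t : gen * gen * gen) := (|e t.1.1 ** e t.1.2, e t.2|).

Lemma coor_is_linear e g : scalar (coor e g).
Proof. by case: g => i k u v /=; rewrite ?linearPl ?linearPr. Qed.

HB.instance Definition _ e g :=
  GRing.isLinear.Build F L F _ (coor e g) (coor_is_linear e g).

Definition symplectic e :=
  [/\ forall i j, (|e (inl i), e (inl j)|) = 0,
      forall i j, (|e (inr i), e (inr j)|) = 0 &
      forall i j, (|e (inl i), e (inr j)|) = (i == j)%:R].

Lemma coor_e e g h : symplectic e -> coor e g (e h) = (g == h)%:R.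
Proof.
move=> [exx eyy exy]; case: g h => [i|i] [j|j] //=.
by rewrite exy eq_sym.
Qed.

Lemma form_dual e g h : symplectic e -> h != dual g -> (|e g, e h|) = 0.
Proof.
move=> se; have [exx eyy exy] := se; case: g h => [i|i] [j|j] //=.
  by rewrite exy (inj_eq inr_inj) eq_sym => /negPf->.
by rewrite formNC exy (inj_eq inl_inj) => /negPf->; rewrite oppr0.
Qed.

(** Pairing with the dual vectors reads off coefficients, so a symplectic family
    is free; ten vectors then form a basis. *)
Lemma symp_basis e : \dim {:L} = 10%N -> symplectic e -> standard_basis e.
Proof.
move=> dL se; have [exx eyy exy] := se; split=> //.
have sz : size (codom e) = 10%N by rewrite size_codom card_sum card_ord.
rewrite basisEfree subvf sz dL leqnn !andbT.
apply/(@freeP _ _ _ (in_tuple (codom e))) => k k0 i.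
have nthE j : (j < 10)%N -> (codom e)`_j = e (nth 'x_1 (enum {:gen}) j).
  by move=> j10; rewrite (nth_map 'x_1)// -cardE card_sum card_ord.
have i10 (j : 'I_(size (codom e))) : (j < 10)%N by rewrite -sz.
have := congr1 (coor e (nth 'x_1 (enum {:gen}) i)) k0.
rewrite linear0 linear_sum (bigD1 i)//= big1 => [|j ji].
  by rewrite linearZ /= nthE// coor_e// eqxx mulr1 addr0.
rewrite linearZ /= nthE// coor_e// nth_uniq ?enum_uniq -?cardE ?card_sum ?card_ord//.
by rewrite -[_ == _ :> nat]/(i == j) eq_sym (negPf ji) mulr0.
Qed.

Section Std.
Variables (e : gen -> L) (se : standard_basis e).

Lemma std_symp : symplectic e. Proof. by case: se. Qed.

Lemma form0_std u : (forall g, (|u, e g|) = 0) -> u = 0.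
Proof.
move=> u0; apply: saa_nondeg => v.
have [/andP[/eqP ef _] _ _ _] := se.
have : (fullv <= perp <[u]>)%VS.
  rewrite -ef; apply/span_subvP => _ /codomP[g ->].
  by apply/mem_perp => _ /vlineP[k ->]; rewrite linearZr_LR /= form0C ?mulr0.
move=> /subvP/(_ v (memvf v))/mem_perp/(_ _ (memv_line u)); exact: form0C.
Qed.

Lemma coor0_std u : (forall g, coor e g u = 0) -> u = 0.
Proof.
move=> u0; apply: form0_std => g; have := u0 (dual g).
by case: g => i //=; exact: form0C.
Qed.

Lemma coor_expand u : u = \sum_g coor e g u *: e g.
Proof.
apply/eqP; rewrite -subr_eq0; apply/eqP/coor0_std => g.
rewrite linearB linear_sum (bigD1 g)//= big1 => [|h hg].
  by rewrite linearZ /= coor_e ?eqxx ?mulr1 ?addr0 ?subrr//; exact: std_symp.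
by rewrite linearZ /= coor_e 1?eq_sym ?(negPf hg) ?mulr0//; exact: std_symp.
Qed.

Lemma form_expand u v :
  (|u, v|) = \sum_g \sum_h coor e g u * coor e h v * (|e g, e h|).
Proof.
rewrite {1}[u]coor_expand linear_sumlz; apply: eq_bigr => g _.
rewrite {1}[v]coor_expand linear_sumr; apply: eq_bigr => h _.
by rewrite linearZl_LR linearZr_LR /= mulrA.
Qed.

Lemma tri_expand u v w : (|u ** v, w|) =
  \sum_g \sum_h \sum_k coor e g u * coor e h v * coor e k w * tri e (g, h, k).
Proof.
rewrite {1}[u]coor_expand linear_sumlz linear_sumlz; apply: eq_bigr => g _.
rewrite {1}[v]coor_expand linear_sumr linear_sumlz; apply: eq_bigr => h _.
rewrite {1}[w]coor_expand linear_sumr; apply: eq_bigr => k _.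
rewrite !(linearZl_LR, linearZr_LR) /=.
by rewrite /tri/= !mulrA; ring.
Qed.

Lemma form_only g h u v :
    (forall g' h', (g', h') != (g, h) -> h' = dual g' ->
      coor e g' u * coor e h' v = 0) ->
  (|u, v|) = coor e g u * coor e h v * (|e g, e h|).
Proof.
move=> H; rewrite form_expand (bigD1 g)//= [X in _ + X]big1 => [|g' g'g].
  rewrite (bigD1 h)//= big1 ?addr0// => h' h'h.
  have [hd|hd] := eqVneq h' (dual g).
    by rewrite H ?mul0r// xpair_eqE negb_and h'h orbT.
  by rewrite (form_dual std_symp) ?mulr0.
rewrite big1// => h' _; have [hd|hd] := eqVneq h' (dual g').
  by rewrite H ?mul0r// xpair_eqE negb_and g'g.
by rewrite (form_dual std_symp) ?mulr0.
Qed.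

(** Triangularity in use: when the supports of [u], [v], [w] leave a single
    product of basis vectors, the value is a monomial in the coordinates. *)
Lemma tri_only g h k u v w :
    (forall g' h' k', (g', h', k') != (g, h, k) -> tri e (g', h', k') != 0 ->
      coor e g' u * coor e h' v * coor e k' w = 0) ->
  (|u ** v, w|) = coor e g u * coor e h v * coor e k w * tri e (g, h, k).
Proof.
move=> H.
have H' g' h' k' : (g', h', k') != (g, h, k) ->
    coor e g' u * coor e h' v * coor e k' w * tri e (g', h', k') = 0.
  have [->|T0] := eqVneq (tri e (g', h', k')) 0; first by rewrite mulr0.
  by move=> ghk; rewrite H ?mul0r.
rewrite tri_expand (bigD1 g)//= [X in _ + X]big1 => [|g' g'g]; last first.
  by rewrite big1// => h' _; rewrite big1// => k' _; rewrite H'// !xpair_eqE (negPf g'g).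
rewrite (bigD1 h)//= [X in _ + X + _]big1 => [|h' h'h]; last first.
  by rewrite big1// => k' _; rewrite H'// !xpair_eqE (negPf h'h) andbF.
rewrite (bigD1 k)//= big1 ?addr0// => k' k'k.
by rewrite H'// !xpair_eqE (negPf k'k) andbF.
Qed.

End Std.
End Basis.

(** * Removing structure constants by transvections *)

Definition uniqt (t : triple) := uniq [:: t.1.1; t.1.2; t.2].

(** The labels of the basis vectors that can occur in the image of the [k]-th
    basis vector under the transvection along [a] and [b] (see [transvect]). *)
Definition moved (a b k : gen) : seq gen :=
  k :: (if k == dual a then [:: b] else [::]) ++
       (if (k == dual b) && (a != b) then [:: a] else [::]).

Definition in_movedt (a b : gen) (t t' : triple) :=
  [&& t'.1.1 \in moved a b t.1.1, t'.1.2 \in moved a b t.1.2 &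
      t'.2 \in moved a b t.2].

(** The converse of [moved]: it lets the effect of a transvection be checked from
    the few listed triples instead of from all triples of labels. *)
Definition back (a b k : gen) : seq gen :=
  k :: (if k == b then [:: dual a] else [::]) ++
       (if (k == a) && (a != b) then [:: dual b] else [::]).

Definition backt (a b : gen) (t : triple) : seq triple :=
  [seq (p, k) | p <- [seq (g, h) | g <- back a b t.1.1, h <- back a b t.1.2],
                k <- back a b t.2].

(** [s] is a triple of the current support [S].  Whatever a transvection can
    feed from [s] is either [t], about to be killed, or a triple that stays in
    the support [S'] without being a pivot of [K]. *)
Definition spares (K S S' : seq triple) (t : triple) (a b : gen) (s : triple) :=
  (listed S' s || permt s t) &&
  all (fun s' => [|| s' == s, ~~ uniqt s' |
                     ~~ listed K s' && (listed S' s' || permt s' t)])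
      (backt a b s).

(** The value at [t] can be killed by the transvection along [a] and [b]: only
    the first label of [t] moves, and replacing it by [b] yields a pivot. *)
Definition killable (K S S' : seq triple) (t : triple) (a b : gen) :=
  [&& b != dual a, t.1.1 == dual a, moved a b t.1.2 == [:: t.1.2],
      moved a b t.2 == [:: t.2] & listed K (b, t.1.2, t.2)] &&
  all (spares K S S' t a b) S.

(** The transvection along [a] and [b] feeds nothing from [S] into [t], so it
    leaves the value at [t] unchanged (see [tri_stays]). *)
Definition stays (S : seq triple) (a b : gen) (t : triple) :=
  forall t', in_movedt a b t t' -> listed S t' -> t' = t.

Definition perms (t : triple) : seq triple :=
  let: (a, b, c) := t in
  [:: (a, b, c); (a, c, b); (b, a, c); (b, c, a); (c, a, b); (c, b, a)].

Lemma permt_perms t t' : permt t t' -> t \in perms t'.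
Proof.
case: t t' => [[a b] c] [[a' b'] c']; rewrite /permt /= => abc.
have small (x y x' y' : gen) : perm_eq [:: x; y] [:: x'; y'] ->
    x = x' /\ y = y' \/ x = y' /\ y = x'.
  move=> xy; have : x \in [:: x'; y'] by rewrite -(perm_mem xy) mem_head.
  rewrite !inE => /orP[] /eqP xE; rewrite xE in xy *.
    by move: xy; rewrite perm_cons => /perm_small_eq-/(_ isT)[->]; left.
  move: xy; rewrite -[[:: x'; y']]/([:: x'] ++ [:: y']) perm_sym perm_catC /= perm_cons.
  by move=> /perm_small_eq-/(_ isT)[->]; right.
have : a \in [:: a'; b'; c'] by rewrite -(perm_mem abc) mem_head.
rewrite !inE => /or3P[] /eqP aE; rewrite {}aE in abc *.
- by move: abc; rewrite perm_cons => /small[] [-> ->]; rewrite eqxx ?orbT.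
- move: abc; rewrite -[X in perm_eq _ X]/([:: a'] ++ [:: b'; c']).
  rewrite perm_sym perm_catC /= perm_cons perm_sym => /small[] [-> ->];
  by rewrite eqxx ?orbT.
move: abc; rewrite -[X in perm_eq _ X]/([:: a'; b'] ++ [:: c']).
rewrite perm_sym perm_catC /= perm_cons perm_sym => /small[] [-> ->];
by rewrite eqxx ?orbT.
Qed.

Lemma permt_sym t t' : permt t t' = permt t' t.
Proof. exact: perm_sym. Qed.

Lemma permt_trans t' t t'' : permt t t' -> permt t' t'' -> permt t t''.
Proof. exact: perm_trans. Qed.

Lemma perms_permt t t' : t \in perms t' -> permt t t'.
Proof.
case: t t' => [[a b] c] [[a' b'] c']; rewrite !inE /permt.
by do ![case/orP]; move/eqP => [-> -> ->] /=; apply/allP => x _ /=; lia.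
Qed.

Lemma listed_perm S t t' : permt t t' -> listed S t = listed S t'.
Proof.
move=> tt'; apply: eq_has => s; apply/idP/idP; apply: permt_trans => //.
by rewrite permt_sym.
Qed.

Lemma uniqt_perm t t' : permt t t' -> uniqt t = uniqt t'.
Proof. exact: perm_uniq. Qed.

Lemma moved_back a b g k : g \in moved a b k -> k \in back a b g.
Proof.
rewrite /moved /back !inE => /orP[/eqP->|]; first by rewrite eqxx.
rewrite !mem_cat => /orP[]; case: ifP => //.
  by move=> /eqP->; rewrite inE => /eqP->; rewrite eqxx mem_head orbT.
by case/andP=> /eqP-> ab; rewrite inE => /eqP->; rewrite eqxx ab mem_head !orbT.
Qed.

(** Moving labels commutes with permuting a triple; this is why representatives
    up to permutation suffice in [spares]. *)
Lemma movedt_backt a b t t' s' : in_movedt a b t t' -> permt t' s' ->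
  exists s, [/\ s \in backt a b s', permt t s & s = s' -> t' = t].
Proof.
case: t t' s' => [[g h] k] [[g' h'] k'] [[g1 h1] k1] /and3P[].
move=> /moved_back gg /moved_back hh /moved_back kk /permt_perms.
rewrite /perms !in_cons in_nil orbF; do ![case/orP]; move=> /eqP[? ? ?]; subst g' h' k'.
- exists (g, h, k); split; last by case=> -> -> ->.
    by rewrite !allpairs_f.
  by apply: perms_permt; rewrite !inE eqxx ?orbT.
- exists (g, k, h); split; last by case=> -> -> ->.
    by rewrite !allpairs_f.
  by apply: perms_permt; rewrite !inE eqxx ?orbT.
- exists (h, g, k); split; last by case=> -> -> ->.
    by rewrite !allpairs_f.
  by apply: perms_permt; rewrite !inE eqxx ?orbT.
- exists (k, g, h); split; last by case=> -> -> ->.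
    by rewrite !allpairs_f.
  by apply: perms_permt; rewrite !inE eqxx ?orbT.
- exists (h, k, g); split; last by case=> -> -> ->.
    by rewrite !allpairs_f.
  by apply: perms_permt; rewrite !inE eqxx ?orbT.
exists (k, h, g); split; last by case=> -> -> ->.
  by rewrite !allpairs_f.
by apply: perms_permt; rewrite !inE eqxx ?orbT.
Qed.

Lemma killableP K S S' t a b : killable K S S' t a b ->
  [/\ b != dual a, t.1.1 = dual a, moved a b t.1.2 = [:: t.1.2],
      moved a b t.2 = [:: t.2] & listed K (b, t.1.2, t.2)] /\
  forall s, uniqt s ->
    (listed K s -> stays S a b s) /\
    (~~ listed S' s -> permt s t \/ ~~ listed S s /\ stays S a b s).
Proof.
move=> /andP[/and5P[ab /eqP ta /eqP mh /eqP mk Kb] /allP chk]; split=> // s us.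
have st : ~~ (~~ listed K s && (listed S' s || permt s t)) -> stays S a b s.
  move=> nok t' t's /hasP[s' s'S /(movedt_backt t's)[s1 [s1s' ss1 ->//]]].
  have /andP[_ /allP/(_ _ s1s')] := chk _ s'S.
  rewrite -(uniqt_perm ss1) us /= -!(listed_perm _ ss1).
  have -> : permt s1 t = permt s t.
    by apply/idP/idP; apply: permt_trans; rewrite // permt_sym.
  by rewrite (negPf nok) orbF => /eqP.
split=> [sK|sS']; first by apply: st; rewrite sK.
have [pst|npst] := boolP (permt s t); [by left | right].
have nok : ~~ (listed S' s || permt s t) by rewrite negb_or sS'.
split; last by apply: st; rewrite negb_and nok orbT.
apply: contra nok => /hasP[s' s'S ss'].
have /andP[/orP[s'S'|s't] _] := chk _ s'S; rewrite (listed_perm _ ss') ?s'S'//.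
by rewrite (permt_trans ss' s't) orbT.
Qed.

Section Kill.
Variables (F : fieldType) (L : saa F).
Implicit Types (u v w : L) (e : gen -> L).

Definition supported e (S : seq triple) := forall t, ~~ listed S t -> tri e t = 0.

Lemma tri_perm e t t' : permt t t' -> tri e t' = 0 -> tri e t = 0.
Proof.
case: t t' => [[a b] c] [[a' b'] c'] /permt_perms + T0.
rewrite /tri /= in T0 *.
rewrite /perms !in_cons in_nil orbF; do ![case/orP] => /eqP[-> -> ->] //=.
- by rewrite triC23 T0 oppr0.
- by rewrite triC T0 oppr0.
- by rewrite -saa_formC T0.
- by rewrite saa_formC T0.
by rewrite triC -saa_formC T0 oppr0.
Qed.

Lemma tri_nuniq e t : ~~ uniqt t -> tri e t = 0.
Proof.
case: t => [[a b] c]; rewrite /uniqt /tri /= !inE andbT negb_and !negbK.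
case/orP => [/orP[]|] /eqP->; rewrite ?saa_mulxx ?linear0l//.
  by rewrite -saa_formC saa_mulxx linear0l.
by rewrite saa_formC saa_mulxx linear0l.
Qed.

Lemma isom_symp (A : saa F) e (e' : gen -> A) :
  (forall g h, (|e' g, e' h|) = (|e g, e h|)) -> symplectic e -> symplectic e'.
Proof. by move=> ee' [exx eyy exy]; split=> i j; rewrite ee'. Qed.

(** The map sending v to v + l ((v, a) b + (v, b) a), which preserves the form when
    (a, b) = 0.  For a = b the two summands coincide and only one is kept, which
    makes the transvection usable in characteristic 2. *)
Definition transvect e (a b : gen) (l : F) (k : gen) : L :=
  e k + (l * (|e k, e a|)) *: e b
      + ((if a == b then 0 else l) * (|e k, e b|)) *: e a.

Section Transvect.
Variables (e : gen -> L) (a b : gen) (l : F).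
Hypotheses (se : symplectic e) (ab : b != dual a).
Let e' := transvect e a b l.
Let eab : (|e a, e b|) = 0. Proof. exact: form_dual. Qed.

Lemma transvect_symp : symplectic e'.
Proof.
apply: isom_symp se => g h.
rewrite /e' /transvect !(linearDl, linearDr) !(linearZl_LR, linearZr_LR) /=.
rewrite !saa_formxx [(|e b, e a|)]form0C// eab.
rewrite [(|e a, e h|)]formNC [(|e b, e h|)]formNC.
by case: eqP => [->|_]; ring.
Qed.

Lemma coor_transvect g k : coor e g (e' k) != 0 -> g \in moved a b k.
Proof.
rewrite /e' /transvect 2!linearD 2!linearZ /= !coor_e// /moved !inE mem_cat.
case: (eqVneq g k) => //= gk; rewrite add0r.
have fd c : (k == dual c) = false -> (|e k, e c|) = 0.
  by move=> kc; apply: form_dual => //; rewrite -(can_eq dualK) dualK eq_sym kc.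
case ka: (k == dual a); case kb: (k == dual b); rewrite ?(fd _ ka) ?(fd _ kb);
  case: (eqVneq a b) => ab'; rewrite ?(mulr0, mul0r, addr0, add0r, eqxx)//= ?inE;
  by case: (eqVneq g a) => //; case: (eqVneq g b) => //;
    rewrite ?(mulr0, mul0r, addr0, add0r, eqxx).
Qed.

Lemma coor_transvect1 k : coor e k (e' k) = 1.
Proof.
rewrite /e' /transvect 2!linearD 2!linearZ /= !coor_e// eqxx.
have ba0 := form0C eab.
have -> : l * (|e k, e a|) * (k == b)%:R = 0.
  by case: eqP => [->|_]; rewrite ?ba0 !(mulr0, mul0r).
have -> : (if a == b then 0 else l) * (|e k, e b|) * (k == a)%:R = 0.
  by case: (k =P a) => [->|_]; rewrite ?eab !(mulr0, mul0r).
by rewrite !addr0.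
Qed.

Lemma transvect_fix k : moved a b k = [:: k] -> e' k = e k.
Proof.
have fd c : (k == dual c) = false -> (|e k, e c|) = 0.
  by move=> kc; apply: form_dual => //; rewrite -(can_eq dualK) dualK eq_sym kc.
move=> /(congr1 size); rewrite /moved /e' /transvect.
case ka: (k == dual a) => //=; rewrite (fd _ ka).
case: (eqVneq a b) => _; rewrite ?andbF.
  by rewrite !(mulr0, mul0r, scale0r, addr0).
by case kb: (k == dual b) => //= _; rewrite (fd _ kb) !(mulr0, scale0r, addr0).
Qed.

Lemma transvect_dual :
  e' (dual a) = e (dual a) + (l * (|e (dual a), e a|)) *: e b.
Proof.
rewrite /e' /transvect; case: eqP => [_|ab']; first by rewrite mul0r scale0r addr0.
rewrite [(|_, e b|)]form_dual ?dualK; first by rewrite mulr0 scale0r addr0.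
  exact: se.
by rewrite eq_sym; apply/eqP.
Qed.
End Transvect.

Lemma tri_stays S e a b l s : \dim {:L} = 10%N -> standard_basis e ->
  b != dual a -> supported e S -> stays S a b s ->
  tri (transvect e a b l) s = tri e s.
Proof.
move=> dL se ab eS sS; have sy := std_symp se.
case: s sS => [[g h] k] sS; rewrite {1}/tri /= (tri_only (g := g) (h := h) (k := k) se).
  by rewrite !coor_transvect1// !mul1r.
move=> g' h' k' ne Tn0; apply/eqP; apply: contraNT ne.
rewrite !mulf_eq0 !negb_or => /andP[/andP[cg ch] ck]; apply/eqP/sS.
  by apply/and3P; split; apply: (coor_transvect (l := l) sy).
by apply: contraNT Tn0 => /eS->.
Qed.

(** The value at [t] becomes its old value plus [l] times a nonzero multiple of a
    pivot, so a suitable [l] makes it vanish. *)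
Lemma kill K S S' t a b e : killable K S S' t a b ->
    \dim {:L} = 10%N -> standard_basis e -> supported e S ->
    (forall s, listed K s -> tri e s != 0) ->
  exists e', [/\ standard_basis e', supported e' S' &
                 forall s, listed K s -> tri e' s != 0].
Proof.
case: t => [[g h] k] /killableP[/= [ab -> mh mk Kb] chk].
move=> dL se eS eK; have sy := std_symp se.
have c0 : (|e (dual a), e a|) != 0.
  have [_ _ exy] := sy; case: {+}a => i /=.
    by rewrite formNC exy eqxx oppr_eq0 oner_eq0.
  by rewrite exy eqxx oner_eq0.
pose l := - (tri e (dual a, h, k) / ((|e (dual a), e a|) * tri e (b, h, k))).
pose e' := transvect e a b l.
have se' : standard_basis e' by apply: symp_basis => //; exact: transvect_symp.
have Tt : tri e' (dual a, h, k) = 0.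
  rewrite /tri /= /e' transvect_dual// !transvect_fix// linearDl linearZl_LR.
  rewrite linearDl linearZl_LR /= -[X in X + _]/(tri e (dual a, h, k)).
  rewrite -[(|e b ** _, _|)]/(tri e (b, h, k)) /l.
  by field; rewrite c0 eK.
exists e'; split => // s Hs; last first.
  have us : uniqt s by apply: contraNT (eK _ Hs) => /tri_nuniq->.
  have [/(_ Hs) st _] := chk s us.
  by rewrite (tri_stays _ dL se ab eS st) eK.
have [us|/tri_nuniq->//] := boolP (uniqt s).
have [_ /(_ Hs)[/tri_perm->//|[sS st]]] := chk s us.
by rewrite (tri_stays _ dL se ab eS st) eS.
Qed.

(** A list of steps: each kills its triple with the transvection along the two
    labels, and the support shrinks to the later triples and the pivots. *)
Fixpoint killable_all K (ks : seq (triple * gen * gen)) :=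
  if ks is (t, a, b) :: r then
    killable K (map (fst \o fst) ks ++ K) (map (fst \o fst) r ++ K) t a b
    &&
    killable_all K r
  else true.

Lemma kill_all K ks e : killable_all K ks ->
    \dim {:L} = 10%N -> standard_basis e ->
    supported e (map (fst \o fst) ks ++ K) ->
    (forall s, listed K s -> tri e s != 0) ->
  exists e', [/\ standard_basis e', supported e' K &
                 forall s, listed K s -> tri e' s != 0].
Proof.
elim: ks e => [|[[t a] b] r IH] e /=; first by exists e.
move=> /andP[/kill k1 k2] dL se eS eK.
by have [e' [se' eS' eK']] := k1 e dL se eS eK; exact: IH eS' eK'.
Qed.

End Kill.

Definition table : seq triple :=
  [:: ('x_2, 'y_3, 'y_5); ('x_3, 'y_4, 'y_5); ('x_1, 'y_2, 'y_5);
      ('x_1, 'y_3, 'y_4); ('y_1, 'y_2, 'y_3)].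

(** The order matters: each step only disturbs triples that are killed later.  In
    each triple the label written first is the one that moves. *)
Definition transvections : seq (triple * gen * gen) :=
  [:: (('y_4, 'y_1, 'y_3), 'x_4, 'y_2); (('y_1, 'y_4, 'y_5), 'x_1, 'x_3);
      (('y_5, 'y_1, 'y_3), 'x_5, 'y_2); (('x_1, 'y_4, 'y_5), 'y_1, 'x_3);
      (('x_2, 'y_4, 'y_5), 'y_2, 'x_3); (('x_1, 'y_3, 'y_5), 'y_1, 'x_2);
      (('y_4, 'y_2, 'y_3), 'x_4, 'y_1); (('y_2, 'y_3, 'y_5), 'x_2, 'x_2);
      (('y_4, 'y_2, 'y_5), 'x_4, 'x_1); (('y_5, 'y_3, 'y_4), 'x_5, 'x_1)].

Lemma transvections_ok : killable_all table transvections.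
Proof. by vm_compute. Qed.

(** * Presentations, rescaling and isomorphisms *)

Section Normal.
Variables (F : fieldType).
Implicit Types (A B L : saa F).

Lemma tri_sign t t' : permt t t' ->
  exists b : bool, forall L (e : gen -> L), tri e t = (-1) ^+ b * tri e t'.
Proof.
case: t t' => [[a b] c] [[a' b'] c'] /permt_perms.
rewrite /perms !in_cons in_nil orbF; do ![case/orP] => /eqP[-> -> ->] //=.
- by exists false => L e; rewrite mul1r.
- by exists true => L e; rewrite mulN1r /tri /= triC23.
- by exists true => L e; rewrite mulN1r /tri /= triC.
- by exists false => L e; rewrite mul1r /tri /= -saa_formC.
- by exists false => L e; rewrite mul1r /tri /= saa_formC.
by exists true => L e; rewrite mulN1r /tri /= triC -saa_formC.
Qed.

Definition normal L (e : gen -> L) (r : F) :=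
  [/\ standard_basis e, supported e table, tri e ('x_2, 'y_3, 'y_5) = r &
      {in behead table, forall t, tri e t = 1}].

Lemma given_byP L r :
  given_by L (P10_2_6 r) <-> exists e : gen -> L, normal e r.
Proof.
split=> -[e [se H1 H2]].
  exists e; split=> //.
  - case=> [[a b] c] nS; apply: H2 => a' b' c' t abct; move: nS; apply: contraNN.
    move=> pt; apply/hasP; exists (a', b', c') => //.
    move: abct; rewrite !inE.
    by do ![case/orP]; move/eqP => [-> -> -> _]; rewrite eqxx ?orbT.
  - by apply: H1; rewrite mem_head.
  - case=> [[a b] c] abc; apply: H1; move: abc; rewrite !inE.
    by do ![case/orP]; move/eqP => [-> -> ->]; rewrite eqxx ?orbT.
move=> H3; exists e; split=> //.
  move=> a b c t; rewrite !inE; do ![case/orP]; move/eqP => [-> -> -> ->].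
  - exact: H2.
  - exact: (H3 ('x_3, 'y_4, 'y_5)).
  - exact: (H3 ('x_1, 'y_2, 'y_5)).
  - exact: (H3 ('x_1, 'y_3, 'y_4)).
  - exact: (H3 ('y_1, 'y_2, 'y_3)).
move=> a b c H; apply: (H1 (a, b, c)); apply/hasPn => -[[a' b'] c'] tab.
suff [t tP] : exists t, (a', b', c', t) \in P10_2_6 r by exact: H tP.
move: tab; rewrite !inE; do ![case/orP]; move/eqP => [-> -> ->];
  first [by exists r; rewrite !inE eqxx | by exists 1; rewrite !inE eqxx ?orbT].
Qed.

Section Rescale.
Variables (L : saa F) (e : gen -> L) (t : 'I_5 -> F).
Hypothesis t0 : forall i, t i != 0.

Definition weight (g : gen) :=
  match g with inl i => t i | inr i => (t i)^-1 end.
Definition rescale g := weight g *: e g.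

Lemma tri_rescale s : tri rescale s =
  weight s.1.1 * weight s.1.2 * weight s.2 * tri e s.
Proof. by rewrite /tri /rescale !(linearZl_LR, linearZr_LR) /=; ring. Qed.

Lemma rescale_symp : symplectic e -> symplectic rescale.
Proof.
case=> exx eyy exy; split=> i j; rewrite /rescale linearZl_LR linearZr_LR /=.
- by rewrite exx !mulr0.
- by rewrite eyy !mulr0.
rewrite exy; case: eqP => [->|_]; last by rewrite !mulr0.
by rewrite mulr1 mulfV.
Qed.

Lemma rescale_supported S : supported e S -> supported rescale S.
Proof. by move=> eS s /eS s0; rewrite tri_rescale s0 mulr0. Qed.
End Rescale.

Lemma dim_std L (e : gen -> L) : standard_basis e -> \dim {:L} = 10%N.
Proof.
by case=> /andP[/eqP <- /eqP->] _ _ _; rewrite size_codom card_sum card_ord.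
Qed.

Definition torus (a b c d f : F) (i : 'I_5) : F := nth 0 [:: a; b; c; d; f] i.

Lemma torus_neq0 a b c d f i : [&& a != 0, b != 0, c != 0, d != 0 & f != 0] ->
  torus a b c d f i != 0.
Proof. by case: i => [[|[|[|[|[|]]]]]] //= ? /and5P[]. Qed.

(** Prescribing t_4 and t_5, the conditions at (x_3, y_4, y_5), (x_1, y_3, y_4) and
    (x_1, y_2, y_5) determine t_3, t_1 and t_2.  The remaining one then asks that
    t_4^5 t_5^2 be a given D, which t_4 = D and t_5 = D^-2 achieve. *)
Lemma normalize L (e : gen -> L) : standard_basis e -> supported e table ->
    (forall s, listed table s -> tri e s != 0) ->
  exists r (e' : gen -> L), r != 0 /\ normal e' r.
Proof.
move=> se eS enz.
pose a := tri e ('x_3, 'y_4, 'y_5); pose b := tri e ('x_1, 'y_2, 'y_5).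
pose c := tri e ('x_1, 'y_3, 'y_4); pose d := tri e ('y_1, 'y_2, 'y_3).
have a0 : a != 0 by exact: enz. have b0 : b != 0 by exact: enz.
have c0 : c != 0 by exact: enz. have d0 : d != 0 by exact: enz.
have r0 : tri e ('x_2, 'y_3, 'y_5) != 0 by exact: enz.
pose D := d * a ^+ 3 * c ^+ 2 / b.
have D0 : D != 0 by rewrite !mulf_neq0 ?invr_eq0 ?expf_neq0.
pose t4 := D; pose t5 := D ^- 2; pose t3 := t4 * t5 / a.
pose t1 := t3 * t4 / c; pose t2 := b * t1 / t5.
have t40 : t4 != 0 by []. have t50 : t5 != 0 by rewrite invr_eq0 expf_neq0.
have t30 : t3 != 0 := mulf_neq0 (mulf_neq0 t40 t50) (invr_neq0 a0).
have t10 : t1 != 0 := mulf_neq0 (mulf_neq0 t30 t40) (invr_neq0 c0).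
have t20 : t2 != 0 := mulf_neq0 (mulf_neq0 b0 t10) (invr_neq0 t50).
pose t := torus t1 t2 t3 t4 t5.
have tn0 i : t i != 0 by apply: torus_neq0; rewrite t10 t20 t30 t40.
exists (tri (rescale e t) ('x_2, 'y_3, 'y_5)), (rescale e t); split.
  rewrite tri_rescale /= /t /torus /=.
  exact: (mulf_neq0 (mulf_neq0 (mulf_neq0 t20 (invr_neq0 t30)) (invr_neq0 t50)) r0).
split=> //.
- apply: symp_basis; first exact: dim_std se.
  by apply: rescale_symp => //; exact: std_symp.
- exact: rescale_supported.
move=> s; rewrite !inE; do ![case/orP]; move/eqP => ->;
  rewrite tri_rescale /= /t /torus /=.
- by rewrite -/a /t3; field; rewrite a0 t40 t50.
- by rewrite -/b /t2; field; rewrite b0 t10 t50.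
- by rewrite -/c /t1; field; rewrite c0 t30 t40.
rewrite -/d /t2 /t1 /t3 /t5 /t4 /D; clearbody a b c d; field.
by rewrite a0 b0 c0 d0 oner_neq0.
Qed.

Lemma normal_isom A B (e : gen -> A) (e' : gen -> B) r :
  normal e r -> normal e' r -> saa_isom A B.
Proof.
move=> [se eS er e1] [se' eS' er' e1'].
have TT s : tri e s = tri e' s.
  have [/hasP[s' s'K /tri_sign[b eb]]|ns] := boolP (listed table s); last first.
    by rewrite eS// eS'.
  rewrite !eb; congr (_ * _); move: s'K; rewrite -[table]/(_ :: behead table).
  by rewrite in_cons => /predU1P[->|s't]; rewrite ?er ?er'// e1 ?e1'.
pose f0 u := \sum_g coor e g u *: e' g.
have fl : linear f0.
  move=> k u v; rewrite scaler_sumr -big_split; apply: eq_bigr => g _ /=.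
  by rewrite linearP scalerDl scalerA.
pose g0 u := \sum_g coor e' g u *: e g.
have cf u g : coor e' g (f0 u) = coor e g u.
  rewrite linear_sum (bigD1 g)//= big1 => [|h hg].
    by rewrite linearZ /= coor_e ?eqxx ?mulr1 ?addr0//; exact: std_symp se'.
  by rewrite linearZ /= coor_e 1?eq_sym ?(negPf hg) ?mulr0//; exact: std_symp se'.
have cg u g : coor e g (g0 u) = coor e' g u.
  rewrite linear_sum (bigD1 g)//= big1 => [|h hg].
    by rewrite linearZ /= coor_e ?eqxx ?mulr1 ?addr0//; exact: std_symp se.
  by rewrite linearZ /= coor_e 1?eq_sym ?(negPf hg) ?mulr0//; exact: std_symp se.
pose f : {linear A -> B} := HB.pack f0 (GRing.isLinear.Build _ _ _ _ _ fl).
have ff u v : (|f0 u, f0 v|) = (|u, v|).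
  rewrite (form_expand se') (form_expand se); apply: eq_bigr => g _.
  apply: eq_bigr => h _; rewrite !cf; congr (_ * _).
  have [exx eyy exy] := std_symp se; have [exx' eyy' exy'] := std_symp se'.
  case: g h => [i|i] [j|j]; rewrite ?exx ?exx' ?eyy ?eyy' ?exy ?exy'//.
  by rewrite formNC exy' formNC exy.
have fe k : f0 (e k) = e' k.
  rewrite /f0 (bigD1 k)//= big1 ?addr0 => [|h hk].
    by rewrite coor_e ?eqxx ?scale1r//; exact: std_symp se.
  by rewrite coor_e ?(negPf hk) ?scale0r//; exact: std_symp se.
exists f; split=> [|//|u v] /=.
  exists g0 => u; [rewrite [RHS](coor_expand se) | rewrite [RHS](coor_expand se')];
    by apply: eq_bigr => g _; rewrite ?cf ?cg.
apply/eqP; rewrite -subr_eq0; apply/eqP/(form0_std se') => k.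
rewrite linearBl /= -[in X in X - _]fe ff; apply/eqP; rewrite subr_eq0; apply/eqP.
rewrite (tri_expand se) (tri_expand se'); do 3![apply: eq_bigr => ? _].
by rewrite !cf TT -fe cf.
Qed.

End Normal.

(** * Comparing two normal bases *)

(** The largest i such that the basis vector lies in L^i. *)
Definition level (g : gen) : nat :=
  match g with
  | inl i => nth 0%N [:: 4; 5; 6; 7; 7]%N i
  | inr i => nth 0%N [:: 4; 3; 2; 1; 1]%N i
  end.

Lemma level_dual g : (level g + level (dual g) = 8)%N.
Proof. by case: g => [[[|[|[|[|[|i]]]]] ?]|[[|[|[|[|[|i]]]]] ?]]. Qed.

(** For a label g, a pair (h, c) such that the value at (g, h, c) is a pivot and
    detects the coordinate g, while the product lands exactly one level
    deeper than g.  The labels x_4 and x_5 have no such pair. *)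
Definition level_witness (g : gen) : gen * gen :=
  match g with
  | inl i => nth ('y_5, 'y_4) [:: ('y_5, 'y_2); ('y_5, 'y_3); ('y_5, 'y_4)] i
  | inr i => nth ('y_5, 'y_4)
     [:: ('y_3, 'y_2); ('y_5, 'x_1); ('y_5, 'x_2); ('y_5, 'x_3); ('y_4, 'x_3)] i
  end.

Lemma level_witnessP : all (fun g => (level g < 7)%N ==>
  let: (h, c) := level_witness g in
  [&& listed table (g, h, c), (level g + level c == 7)%N &
      all (fun g' => (g' == g) || ~~ listed table (g', h, c)) gens]) gens.
Proof. by vm_compute. Qed.

Lemma gensP (P : pred gen) g : all P gens -> P g.
Proof. by move=> /allP; apply; exact: mem_gens. Qed.

Definition table_orbits : seq triple := flatten [seq perms t | t <- table].

Lemma listed_orbits t : listed table t -> t \in table_orbits.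
Proof. by case/hasP => s st /permt_perms ts; apply/flatten_mapP; exists s. Qed.

Lemma table_orbitsP (P : pred triple) t :
  all P table_orbits -> listed table t -> P t.
Proof. by move=> /allP aP /listed_orbits/aP. Qed.

Lemma table_levels g h k : listed table (g, h, k) -> (level g + level k <= 7)%N.
Proof.
by apply: (@table_orbitsP (fun t => (level t.1.1 + level t.2 <= 7)%N)); vm_compute.
Qed.

Lemma table_third g h k k' :
  listed table (g, h, k) -> listed table (g, h, k') -> k' = k.
Proof.
move=> /listed_orbits ghk /listed_orbits ghk'; apply/eqP.
have : all (fun t => all (fun t' =>
    (t'.1 == t.1) ==> (t'.2 == t.2)) table_orbits) table_orbits.
  by vm_compute.
by move=> /allP/(_ _ ghk)/allP/(_ _ ghk') /=; rewrite eqxx.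
Qed.

(** The positions at which the transition matrix between two normal bases may be
    nonzero: the three excluded pairs make the blocks of size 2 triangular. *)
Definition low (g h : gen) :=
  (level g <= level h)%N &&
  ((g, h) \notin [:: ('x_5, 'x_4); ('y_4, 'y_5); ('x_1, 'y_1)]).

Lemma low_dual i h : low i h -> low (dual i) (dual h) -> h = i.
Proof.
have : all (fun i => all (fun h =>
    low i h ==> low (dual i) (dual h) ==> (h == i)) gens) gens by vm_compute.
move=> /allP/(_ i (mem_gens i))/allP/(_ h (mem_gens h)) + l1 l2.
by rewrite l1 l2 => /eqP.
Qed.

Lemma low_table t t' : t \in table -> listed table t' ->
  [&& low t.1.1 t'.1.1, low t.1.2 t'.1.2 & low t.2 t'.2] -> t' = t.
Proof.
have : all (fun t => all (fun t' =>
    [&& low t.1.1 t'.1.1, low t.1.2 t'.1.2 & low t.2 t'.2] ==> (t' == t))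
  table_orbits) table by vm_compute.
by move=> /allP + tt /listed_orbits t'r => /(_ _ tt)/allP/(_ _ t'r)/implyP H /H/eqP.
Qed.

(** The equations give y_3 = y_4 y_5, y_2 = y_4^2, y_1 = y_4^2 y_5, and then
    y_4^5 y_5^2 = 1.  Modulo this last relation the ratio y_5^2 / y_4 equals
    (y_4^2 y_5)^12, as (y_4^2 y_5)^12 = (y_5^2 / y_4) (y_4^5 y_5^2)^5. *)
Lemma torus_ratio (F : fieldType) (x1 x2 x3 y1 y2 y3 y4 y5 : F) :
    x1 * y1 = 1 -> x2 * y2 = 1 -> x3 * y3 = 1 ->
    x3 * y4 * y5 = 1 -> x1 * y2 * y5 = 1 -> x1 * y3 * y4 = 1 ->
    y1 * y2 * y3 = 1 ->
  exists2 a, a != 0 & x2 * y3 * y5 = a ^+ 12.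
Proof.
have unit2 (a b c : F) : a * b = 1 -> a * c = 1 -> b = c.
  move=> ab ac; have a0 : a != 0.
    by apply/eqP => a0; move/eqP: ab; rewrite a0 mul0r eq_sym oner_eq0.
  by apply: (mulfI a0); rewrite ab ac.
move=> d1 d2 d3 e345 e125 e134 e123.
have y3E : y3 = y4 * y5 by apply: (unit2 x3); rewrite // mulrA.
have y1E : y1 = y4 ^+ 2 * y5 by apply: (unit2 x1) => //; rewrite -e134 y3E; ring.
have y5n : y5 != 0.
  by apply/eqP => z; move/eqP: e125; rewrite z mulr0 eq_sym oner_eq0.
have y4n : y4 != 0.
  by apply/eqP => z; move/eqP: e134; rewrite z mulr0 eq_sym oner_eq0.
have y2E : y2 = y4 ^+ 2.
  apply: (mulIf y5n); rewrite -y1E; apply: (unit2 x1) => //.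
  by rewrite mulrA e125.
have x2E : x2 = y4 ^- 2.
  by apply: (unit2 y2); rewrite ?[y2 * x2]mulrC// y2E mulfV// expf_neq0.
move: e123; rewrite y1E y2E y3E => pq.
exists (y4 ^+ 2 * y5); first by rewrite mulf_neq0 ?expf_neq0.
have -> : (y4 ^+ 2 * y5) ^+ 12 =
    y5 ^+ 2 / y4 * (y4 ^+ 2 * y5 * y4 ^+ 2 * (y4 * y5)) ^+ 5 by field.
by rewrite pq x2E; field.
Qed.

Section Compare.
Variables (F : fieldType) (L : saa F).
Implicit Types (u v w : L) (e : gen -> L).

(** Membership of [u] in the k-th term of the upper central series; isomorphisms
    and changes of basis respect it by construction. *)
Fixpoint ucs k u : Prop :=
  if k is k'.+1 then forall v, ucs k' (u ** v) else u = 0.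

Lemma tri_table0 e u v w : standard_basis e -> supported e table ->
    (forall g h k, listed table (g, h, k) ->
      coor e g u * coor e h v * coor e k w = 0) ->
  (|u ** v, w|) = 0.
Proof.
move=> se eS H; rewrite (tri_expand se) big1// => g _; rewrite big1// => h _.
rewrite big1// => k _; have [/H->|/eS->] := boolP (listed table (g, h, k)).
  by rewrite mul0r.
by rewrite mulr0.
Qed.

Lemma tri_table e g h k u v w : standard_basis e -> supported e table ->
    (forall g' h' k', listed table (g', h', k') -> (g', h', k') != (g, h, k) ->
      coor e g' u * coor e h' v * coor e k' w = 0) ->
  (|u ** v, w|) = coor e g u * coor e h v * coor e k w * tri e (g, h, k).
Proof.
move=> se eS H; apply: (tri_only (g := g) (h := h) (k := k) se).
move=> g' h' k' ne Tn0; apply: H => //.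
by apply: contraNT Tn0 => /eS->.
Qed.

(** In a normal basis the product of two basis vectors is a multiple of a third
    one: a pair of labels lies in at most one triple of the presentation. *)
Lemma mul_table e t w : standard_basis e -> supported e table ->
  listed table t -> (|e t.1.1 ** e t.1.2, w|) = tri e t * coor e t.2 w.
Proof.
case: t => [[g h] k] se eS gt; rewrite [w in LHS](coor_expand se) linear_sumr /=.
rewrite (bigD1 k)//= big1 => [|k' k'k]; rewrite linearZr_LR /= mulrC ?addr0//.
have : tri e (g, h, k') = 0.
  by apply: eS; apply: contra k'k => /(table_third gt)->.
by rewrite /tri /= => ->; rewrite mul0r.
Qed.

Lemma coor_form e g u : coor e g u = 0 <-> (|u, e (dual g)|) = 0.
Proof. by case: g => i //=; split; exact: form0C. Qed.

Lemma normal_neq0 e r : r != 0 -> normal e r ->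
  forall t, listed table t -> tri e t != 0.
Proof.
move=> r0 [_ _ er e1] t /hasP[t' t'K /(tri_sign F)[b tb]]; rewrite tb.
rewrite mulf_neq0 ?signr_eq0//; move: t'K; rewrite -[table]/(_ :: behead table).
by rewrite in_cons => /predU1P[->|/e1->]; rewrite ?er ?oner_neq0.
Qed.

(** By induction on [k].  Multiplication by a basis vector raises the level, which
    gives one direction; conversely the product with the basis vector chosen in
    [level_witness] shows a coordinate of too small a level. *)
Lemma ucs_level e r : r != 0 -> normal e r -> forall k u,
  ucs k u <-> (forall g, (level g + k < 8)%N -> coor e g u = 0).
Proof.
move=> r0 ne; have tn0 := normal_neq0 r0 ne; have [se eS _ _] := ne.
elim=> [|k IH] u.
  split=> [-> g _|u0]; first by rewrite linear0.
  apply: (coor0_std se) => g; apply: u0; rewrite addn0.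
  by case: g => [[[|[|[|[|[|i]]]]] ?]|[[|[|[|[|[|i]]]]] ?]].
split=> /= [uk g lg|u0 v].
  have := allP level_witnessP g (mem_gens g); have -> : (level g < 7)%N by lia.
  rewrite implyTb.
  case: (level_witness g) => h c /and3P[gt /eqP lc /allP ug].
  have /IH/(_ (dual c)) := uk (e h).
  have -> : (level (dual c) + k < 8)%N by have := level_dual c; lia.
  move=> /(_ isT)/coor_form; rewrite dualK.
  rewrite (tri_table (g := g) (h := h) (k := c) se eS) => [|g' h' k' g't gn]; last first.
    rewrite !(coor_e _ _ (std_symp se)).
    case: (eqVneq h' h) => [hh|_]; last by rewrite !(mulr0, mul0r).
    case: (eqVneq k' c) => [kc|_]; last by rewrite !(mulr0, mul0r).
    have := ug g' (mem_gens g'); rewrite -hh -kc g't orbF => /eqP gg.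
    by rewrite gg hh kc eqxx in gn.
  rewrite !coor_e ?eqxx ?mulr1; [|exact: std_symp se..].
  by move/eqP; rewrite mulf_eq0 (negPf (tn0 _ gt)) orbF => /eqP.
apply/IH => g lg; apply/coor_form; apply: (tri_table0 se eS) => g' h' k' gt.
have [lg'|lg'] := leqP 8 (level g' + k.+1)%N; last by rewrite u0// !mul0r.
rewrite coor_e; last exact: std_symp se.
have := table_levels gt; case: (eqVneq k' (dual g)) => [->|_]; rewrite ?mulr0//.
by have := level_dual g; lia.
Qed.


Section TwoBases.
Variables (e e' : gen -> L) (r s : F).
Hypotheses (r0 : r != 0) (s0 : s != 0) (ne : normal e r) (ne' : normal e' s).
Let se : standard_basis e. Proof. by case: ne. Qed.
Let se' : standard_basis e'. Proof. by case: ne'. Qed.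
Let eS : supported e table. Proof. by case: ne. Qed.
Let eS' : supported e' table. Proof. by case: ne'. Qed.
Let sy := std_symp se.
Let sy' := std_symp se'.

Lemma coor_level g h : (level h < level g)%N -> coor e h (e' g) = 0.
Proof.
move=> hg; have := level_dual g => lg.
have /(ucs_level r0 ne)/(_ h) : ucs (8 - level g) (e' g).
  apply/(ucs_level s0 ne') => k kg; rewrite coor_e//.
  by case: eqP => // kE; rewrite kE in kg; lia.
by apply; lia.
Qed.

Lemma coor_prod2 g h g' h' c :
  ~~ ((level g <= level g')%N && (level h <= level h')%N) ->
  coor e g' (e' g) * coor e h' (e' h) * c = 0.
Proof. by rewrite negb_and -!ltnNge => /orP[] /coor_level->; rewrite !(mulr0, mul0r). Qed.

(** The product of e'_{x_2} and e'_{y_3} is a nonzero multiple of e'_{x_5}; computed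
    from the levels of its factors it is orthogonal to e_{y_4}. *)
Lemma coor_x5x4 : coor e 'x_4 (e' 'x_5) = 0.
Proof.
have [_ _ es _] := ne'.
have := mul_table (t := ('x_2, 'y_3, 'y_5)) (e 'y_4) se' eS' isT.
rewrite es /= (tri_table0 se eS) => [/esym/eqP|g h k ghk].
  by rewrite mulf_eq0 (negPf s0) => /eqP.
have [kE|kn] := eqVneq k 'y_4; last by rewrite [coor e k _]coor_e// (negPf kn) mulr0.
apply: coor_prod2; have := table_orbitsP (P := fun t => (t.2 == 'y_4) ==>
  ~~ ((level 'x_2 <= level t.1.1)%N && (level 'y_3 <= level t.1.2)%N)) _ ghk.
by rewrite kE; apply; vm_compute.
Qed.

Lemma coor_diag i :
  (forall h, h != inl i ->
     coor e h (e' (inl i)) * coor e (dual h) (e' (inr i)) = 0) ->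
  coor e (inl i) (e' (inl i)) * coor e (inr i) (e' (inr i)) = 1.
Proof.
move=> H; have [_ _ exy] := sy; have [_ _ exy'] := sy'.
have := exy' i i; rewrite (form_only (g := inl i) (h := inr i) se).
  by rewrite exy !eqxx mulr1.
move=> g h gh hE; rewrite hE H//; apply: contra gh => /eqP gE.
by rewrite hE gE.
Qed.

Lemma coor_x5 h : h != 'x_5 -> coor e h (e' 'x_5) = 0.
Proof.
move=> h5; have [/coor_level//|h7] := ltnP (level h) (level 'x_5).
suff /eqP-> : h == 'x_4 by exact: coor_x5x4.
have := gensP (P := fun h => (h != 'x_5) && (7 <= level h)%N ==> (h == 'x_4)) h.
by rewrite h5 h7; apply; vm_compute.
Qed.

(** Dual to [coor_x5x4]: e'_{y_4} is orthogonal to e'_{x_5}, a multiple of e_{x_5}. *)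
Lemma coor_y4y5 : coor e 'y_5 (e' 'y_4) = 0.
Proof.
have d5 : coor e 'x_5 (e' 'x_5) * coor e 'y_5 (e' 'y_5) = 1.
  by apply: coor_diag => h h5; rewrite coor_x5 ?mul0r.
have /form0C : (|e' 'y_4, e' 'x_5|) = 0 by apply: form_dual.
rewrite (form_only (g := 'x_5) (h := 'y_5) se) => [|g h gh hE].
  have [_ _ ->] := sy; rewrite eqxx mulr1 => /eqP; rewrite mulf_eq0 => /orP[]/eqP// c0.
  by move/eqP: d5; rewrite c0 mul0r eq_sym oner_eq0.
by rewrite coor_x5 ?mul0r//; apply: contra gh => /eqP gE; rewrite hE gE.
Qed.

(** The product of e'_{x_1} and e'_{y_2} is e'_{x_5}, hence orthogonal to e_{y_3},
    whereas a component of e'_{x_1} along e_{y_1} would contribute a multiple of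
    e_{y_1} e_{y_2} = e_{x_3}. *)
Lemma coor_x1y1 : coor e 'y_1 (e' 'x_1) = 0.
Proof.
have d2 : coor e 'x_2 (e' 'x_2) * coor e 'y_2 (e' 'y_2) = 1.
  apply: coor_diag => h h2.
  have [/coor_level->|l2] := ltnP (level h) (level 'x_2); first by rewrite mul0r.
  have [/coor_level->|l3] := ltnP (level (dual h)) (level 'y_2); first by rewrite mulr0.
  have := gensP (P := fun h =>
    [&& 5 <= level h & 3 <= level (dual h)]%N ==> (h == 'x_2)) h.
  by rewrite l2 l3 (negPf h2) => /(_ isT).
have [_ _ _ e1] := ne; have [_ _ _ e1'] := ne'.
have := mul_table (t := ('x_1, 'y_2, 'y_5)) (e 'y_3) se' eS' isT.
rewrite e1' ?inE ?eqxx ?orbT//= mul1r -/(coor e 'x_3 (e' 'x_5)) coor_level//.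
rewrite (tri_table (g := 'y_1) (h := 'y_2) (k := 'y_3) se eS).
  rewrite e1 ?inE ?eqxx ?orbT// mulr1 coor_e// eqxx mulr1 => /eqP.
  rewrite mulf_eq0 => /orP[]/eqP// c0.
  by move/eqP: d2; rewrite c0 mulr0 eq_sym oner_eq0.
move=> g h k ghk ne0.
have [kE|kn] := eqVneq k 'y_3; last by rewrite [coor e k _]coor_e// (negPf kn) mulr0.
apply: coor_prod2; have := table_orbitsP (P := fun t =>
  (t.2 == 'y_3) && (t != ('y_1, 'y_2, 'y_3)) ==>
  ~~ ((level 'x_1 <= level t.1.1)%N && (level 'y_2 <= level t.1.2)%N)) _ ghk.
by rewrite kE eqxx; rewrite kE in ne0; rewrite ne0; apply; vm_compute.
Qed.

Lemma coor_low g h : ~~ low g h -> coor e h (e' g) = 0.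
Proof.
rewrite negb_and negbK -ltnNge => /orP[/coor_level//|].
rewrite !inE => /or3P[] /eqP[-> ->].
- exact: coor_x5x4.
- exact: coor_y4y5.
exact: coor_x1y1.
Qed.

Let m g := coor e g (e' g).

Lemma diag_dual i : m (inl i) * m (inr i) = 1.
Proof.
apply: coor_diag => h hi.
have [l1|/coor_low->] := boolP (low (inl i) h); last by rewrite mul0r.
have [l2|/coor_low->] := boolP (low (dual (inl i)) (dual h)); last by rewrite mulr0.
by rewrite (low_dual l1 l2) eqxx in hi.
Qed.

Lemma diag_table t : t \in table ->
  tri e' t = m t.1.1 * m t.1.2 * m t.2 * tri e t.
Proof.
case: t => [[g h] k] tt; rewrite /tri /= (tri_table (g := g) (h := h) (k := k) se eS)//.
move=> g' h' k' t't; apply: contraNeq; rewrite !mulf_eq0 !negb_or.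
move=> /andP[/andP[cg ch] ck]; apply/eqP/(low_table tt t't).
by apply/and3P; split => /=; [move: cg|move: ch|move: ck];
  apply: contraR => /coor_low->.
Qed.

Lemma normal_ratio : exists2 a : F, a != 0 & s / r = a ^+ 12.
Proof.
have [_ _ er e1] := ne; have [_ _ es e1'] := ne'.
have eq1 t : t \in behead table -> m t.1.1 * m t.1.2 * m t.2 = 1.
  move=> tt; have := @diag_table t; rewrite e1// e1'// mulr1 => <-//.
  by rewrite -[table]/(_ :: behead table) in_cons tt orbT.
have := @diag_table ('x_2, 'y_3, 'y_5) isT; rewrite es er /= => sE.
have [a a0 aE] := torus_ratio (diag_dual (Ordinal (isT : 0 < 5)%N))
  (diag_dual (Ordinal (isT : 1 < 5)%N)) (diag_dual (Ordinal (isT : 2 < 5)%N))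
  (eq1 ('x_3, 'y_4, 'y_5) isT) (eq1 ('x_1, 'y_2, 'y_5) isT)
  (eq1 ('x_1, 'y_3, 'y_4) isT) (eq1 ('y_1, 'y_2, 'y_3) isT).
by exists a; rewrite // sE mulfK.
Qed.

End TwoBases.
End Compare.

Lemma saa_isom_normal (F : fieldType) (A B : saa F) (e : gen -> A) r :
  saa_isom A B -> \dim {:B} = 10%N -> normal e r ->
  exists e' : gen -> B, normal e' r.
Proof.
move=> [f [_ ff fm]] dB [se eS er e1]; exists (f \o e).
have TE t : tri (f \o e) t = tri e t by rewrite /tri /= -fm ff.
split=> [|t /eS||t /e1]; rewrite ?TE//.
by apply: symp_basis => //; apply: (isom_symp _ (std_symp se)) => g h /=.
Qed.

Lemma presentations_isom (F : fieldType) (r s : F) (A B : saa F) :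
    r != 0 -> s != 0 -> given_by A (P10_2_6 r) -> given_by B (P10_2_6 s) ->
  saa_isom A B <-> exists2 a : F, a != 0 & s / r = a ^+ 12.
Proof.
move=> r0 s0 /given_byP[e ne] /given_byP[e' ne']; split.
  case: (ne') => /dim_std dB _ _ _ /saa_isom_normal/(_ dB ne)[e2 ne2].
  exact: normal_ratio ne2 ne'.
move=> [a a0 /(canRL (divfK r0)) sE].
have [se eS er e1] := ne.
(* the one-parameter torus fixing the four unit pivots: t_4 = a^2, t_5 = a^-5 *)
pose t := torus a^-1 (a ^+ 4) (a ^- 3) (a ^+ 2) (a ^- 5).
have tn0 i : t i != 0.
  by apply: torus_neq0; rewrite !invr_eq0 !expf_neq0 ?a0.
apply: (normal_isom (e := rescale e t) _ ne'); split.
- apply: symp_basis; first exact: dim_std se.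
  by apply: rescale_symp => //; exact: std_symp.
- exact: rescale_supported.
- by rewrite tri_rescale er sE /t /torus /=; field; rewrite a0 oner_neq0.
move=> q qt; rewrite tri_rescale e1// mulr1; move: qt; rewrite !inE.
by do ![case/orP]; move/eqP => ->; rewrite /t /torus /=; field; rewrite a0 ?oner_neq0.
Qed.

(** * Dimensions of the lower central series *)

Section Vect.
Variables (F : fieldType) (V : vectType F).
Implicit Types (U W : {vspace V}) (u v w : V).

Lemma dim_lt_pick U W : (\dim U < \dim W)%N -> exists2 w, w \in W & w \notin U.
Proof.
move=> lt; have : ~~ (W <= U)%VS by apply: contraTN lt => /dimvS; rewrite -leqNgt.
by case/subvPn => w wW wU; exists w.
Qed.

Lemma dim_add_line U w : w \notin U -> \dim (U + <[w]>) = (\dim U).+1.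
Proof.
move=> wU; have := dimv_sum_cap U <[w]>; rewrite dim_vline.
have w0 : w != 0 by apply: contraNneq wU => ->; rewrite mem0v.
have -> : (U :&: <[w]> = 0)%VS.
  apply/eqP; rewrite -subv0; apply/subvP => x; rewrite memv_cap => /andP[+ /vlineP[k xE]].
  rewrite {x}xE.
  rewrite memv0; have [->|k0] := eqVneq k 0; first by rewrite scale0r.
  by move=> /(memvZ k^-1); rewrite scalerA mulVf// scale1r (negPf wU).
by rewrite dimv0 w0; lia.
Qed.

Lemma line_complement U W w : (U <= W)%VS -> w \in W -> w \notin U ->
  (\dim W <= (\dim U).+1)%N -> forall v, v \in W -> exists k, v - k *: w \in U.
Proof.
move=> UW wW wU dW v vW.
have : (U + <[w]> == W)%VS.
  by rewrite eqEdim dim_add_line// dW subv_add UW -memvE wW.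
move=> /eqP UWE; move: vW; rewrite -UWE => /memv_addP[u uU [_ /vlineP[k ->] ->]].
by exists k; rewrite addrK.
Qed.
End Vect.

Section Lcs.
Variables (F : fieldType) (L : saa F).
Implicit Types (U V W : {vspace L}) (u v w : L).

Lemma mem_mul_vs U V u v : u \in U -> v \in V -> u ** v \in mul_vs U V.
Proof. by have /mul_vs_subP := subvv (mul_vs U V); apply. Qed.

Lemma mul_vsSl U V W : (U <= V)%VS -> (mul_vs U W <= mul_vs V W)%VS.
Proof.
by move=> /subvP UV; apply/mul_vs_subP => u w /UV uV wW; exact: mem_mul_vs.
Qed.

Lemma perpK V : perp (perp V) = V.
Proof.
apply/esym/eqP; rewrite eqEdim sub_perpC//=.
by have := dim_perp V; have := dim_perp (perp V); lia.
Qed.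

Lemma perpPn V u : u \notin perp V -> exists2 v, v \in V & (|u, v|) != 0.
Proof.
move=> uV; have : ~~ (V <= perp <[u]>)%VS.
  apply: contra uV => /sub_perpC/subvP; apply; exact: memv_line.
case/subvPn => v vV vu; exists v => //; apply: contra vu => /eqP uv0.
by apply/mem_perp => _ /vlineP[k ->]; rewrite linearZr_LR /= form0C ?mulr0.
Qed.

(** This makes the orthogonals of the lower central series the terms of the upper
    central series. *)
Lemma mem_perp_mul V u :
  u \in perp (mul_vs V fullv) <-> forall v, u ** v \in perp V.
Proof.
split=> [/mem_perp uV v|uV].
  by apply/mem_perp => w wV; rewrite tri_form uV// mem_mul_vs ?memvf.
suff : (mul_vs V fullv <= perp <[u]>)%VS.
  by move=> /sub_perpC/subvP; apply; exact: memv_line.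
apply/mul_vs_subP => w v wV _; apply/mem_perp => _ /vlineP[k ->].
by rewrite linearZr_LR /= form0C ?mulr0// -tri_form; apply/mem_perp : wV.
Qed.

Lemma lcsS i : lcs L i.+2 = mul_vs (lcs L i.+1) fullv. Proof. by []. Qed.

Lemma lcs_sub i : (lcs L i.+2 <= lcs L i.+1)%VS.
Proof.
elim: i => [|i IH]; first exact: subvf.
by rewrite lcsS [in X in (_ <= X)%VS]lcsS mul_vsSl.
Qed.

Lemma lcs_le i j : (i <= j)%N -> (lcs L j.+1 <= lcs L i.+1)%VS.
Proof.
move=> /subnK<-; elim: (j - i)%N => [|k IH]; first exact: subvv.
by apply: subv_trans IH; exact: lcs_sub.
Qed.

Lemma lcs_stable i k : lcs L i.+2 = lcs L i.+1 -> lcs L (k + i).+1 = lcs L i.+1.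
Proof. by move=> H; elim: k => // k IH; rewrite addSn lcsS IH -lcsS. Qed.

Lemma lcs_perp c i j : lcs L c.+1 = 0%VS -> (c <= i + j)%N ->
  (lcs L j.+1 <= perp (lcs L i.+1))%VS.
Proof.
move=> c0; elim: j i => [|j IH] i.
  rewrite addn0 => ci; have := lcs_le ci; rewrite c0 subv0 => /eqP->.
  by apply/subvP => u _; apply/mem_perp => v; rewrite memv0 => /eqP->; rewrite linear0r.
rewrite addnS -addSn => /IH ij; apply: sub_perpC; apply/subvP => u uL.
apply/mem_perp_mul => v; apply/(subvP (sub_perpC ij)).
by rewrite lcsS mem_mul_vs ?memvf.
Qed.

Lemma center_perp : center L = perp (lcs L 2).
Proof.
apply/vspaceP => u; rewrite mem_transp memvf /=; apply/idP/idP.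
  move=> /mul_vs_subP u0; apply/mem_perp_mul => v.
  have : u ** v \in (0%VS : {vspace L}) by rewrite u0 ?memv_line ?memvf.
  by rewrite memv0 => /eqP->; rewrite mem0v.
move=> /mem_perp_mul u0; apply/mul_vs_subP => _ v /vlineP[k ->] _.
rewrite linearZl_LR memvZ// memv0; apply/eqP/saa_nondeg => w.
by have /mem_perp := u0 v; apply; exact: memvf.
Qed.

End Lcs.

Section Dims.
Variables (F : fieldType) (L : saa F).
Implicit Types (U V W : {vspace L}) (u v w : L).
Hypotheses (dL : \dim {:L} = 10%N) (c7 : has_class L 7).
Hypothesis dZ : \dim (center L) = 2%N.

Lemma lcs8 : lcs L 8 = 0%VS. Proof. by case: c7. Qed.

Lemma lcs7 : lcs L 7 <> 0%VS.
Proof. by case: c7 => _ H /(H 6). Qed.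

Lemma lcs_strict i : (i < 7)%N -> (\dim (lcs L i.+2) < \dim (lcs L i.+1))%N.
Proof.
move=> i7; rewrite ltn_neqAle dimvS ?lcs_sub// andbT; apply/negP => /eqP dE.
have /eqP/lcs_stable st : lcs L i.+2 == lcs L i.+1 by rewrite eqEdim lcs_sub dE leqnn.
apply: lcs7; have := st (6 - i)%N; have := st (7 - i)%N.
by rewrite !subnK// ?(ltnW i7)// lcs8 => ->.
Qed.

Lemma dim_lcs2 : \dim (lcs L 2) = 8%N.
Proof. by have := dim_perp (lcs L 2); rewrite -center_perp dZ dL; lia. Qed.

Lemma form_lcs i j u v : (7 <= i + j)%N -> u \in lcs L i.+1 -> v \in lcs L j.+1 ->
  (|u, v|) = 0.
Proof.
move=> ij uL vL; have /subvP/(_ v vL)/mem_perp/(_ u uL) := lcs_perp lcs8 ij.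
exact: form0C.
Qed.

Lemma mul_lcs i j u v : (6 <= i + j)%N -> u \in lcs L i.+1 -> v \in lcs L j.+1 ->
  u ** v = 0.
Proof.
move=> ij uL vL; apply: saa_nondeg => w; rewrite tri_form mulNC linearNr.
rewrite (form_lcs (i := i) (j := j.+1)) ?oppr0 ?addnS//.
by rewrite lcsS mem_mul_vs ?memvf.
Qed.

(** L is generated modulo L^2 by two elements a and b, so L^2 is generated modulo
    L^3 by the single product ab. *)
Lemma dim_lcs3 : \dim (lcs L 3) = 7%N.
Proof.
have lt := @lcs_strict 1 isT; rewrite dim_lcs2 in lt.
have [a _ a2] : exists2 a, a \in fullv & a \notin lcs L 2.
  by apply: dim_lt_pick; rewrite dim_lcs2 dL.
have [b _ bU] : exists2 b, b \in fullv & b \notin (lcs L 2 + <[a]>)%VS.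
  by apply: dim_lt_pick; rewrite dim_add_line// dim_lcs2 dL.
have dec u : exists k l x, [/\ u = k *: a + l *: b + x & x \in lcs L 2].
  have [|l] := line_complement (subvf _) (memvf b) bU _ (memvf u).
    by rewrite dim_add_line// dim_lcs2 dL.
  move=> /memv_addP[x xL [_ /vlineP[k ->] E]]; exists k, l, x; split=> //.
  by rewrite addrAC [k *: a + x]addrC -E subrK.
have L3l x v : x \in lcs L 2 -> x ** v \in lcs L 3.
  by move=> xL; rewrite lcsS mem_mul_vs ?memvf.
have L3r x v : x \in lcs L 2 -> v ** x \in lcs L 3.
  by move=> xL; rewrite mulNC memvN L3l.
have : (lcs L 2 <= lcs L 3 + <[a ** b]>)%VS.
  apply/mul_vs_subP => u v _ _.
  have [k [l [x [-> xL]]]] := dec u; have [k' [l' [y [-> yL]]]] := dec v.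
  set p := k *: a + l *: b; set q := k' *: a + l' *: b.
  have -> : (p + x) ** (q + y) = p ** y + x ** (q + y) + p ** q.
    by rewrite linearDl [p ** (q + y)]linearDr -addrA addrC.
  apply: memv_add; first by apply: memvD; [exact: L3r | exact: L3l].
  have -> : p ** q = (k * l' - l * k') *: (a ** b); last by rewrite memvZ ?memv_line.
  rewrite /p /q !linearDl !linearDr !(linearZl_LR, linearZr_LR) !saa_mulxx.
  rewrite [b ** a]mulNC !(scaler0, add0r, addr0) !scalerN !scalerA.
  by rewrite -scalerBl.
move=> /dimvS; rewrite dim_lcs2 => dd.
have := dimv_sum_cap (lcs L 3) <[a ** b]>%VS; have := dim_vline (a ** b).
by move=> ->; case: (_ != _); lia.
Qed.

(** If L^7 were a line, its orthogonal would be a hyperplane H, whose products lie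
    in the orthogonal of L^6.  L being spanned by H and one vector, L^2 would be
    orthogonal to L^6, so L^6 would be central and L^7 trivial. *)
Lemma dim_lcs7 : \dim (lcs L 7) = 2%N.
Proof.
have le2 : (\dim (lcs L 7) <= 2)%N.
  by have := dimvS (lcs_perp lcs8 (isT : 7 <= 1 + 6)%N); rewrite -center_perp dZ.
have d7 : \dim (lcs L 7) != 0%N by rewrite dimv_eq0; apply/eqP; exact: lcs7.
suff : \dim (lcs L 7) != 1%N by lia.
apply/negP => /eqP d1; have := dim_perp (lcs L 7); rewrite d1 dL => dP.
have [a _ aP] : exists2 a, a \in fullv & a \notin perp (lcs L 7).
  by apply: dim_lt_pick; rewrite dL; lia.
have dec u : exists k, u - k *: a \in perp (lcs L 7).
  by apply: (line_complement (subvf _) (memvf a) aP _ (memvf u)); rewrite dL; lia.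
apply: lcs7; apply/eqP; rewrite -subv0.
have /sub_perpC sP : (lcs L 2 <= perp (lcs L 6))%VS.
  apply/mul_vs_subP => u v _ _; have [k uk] := dec u; have [l vl] := dec v.
  have -> : u ** v = (u - k *: a) ** v - (v - l *: a) ** (k *: a).
    rewrite linearBl /= [in X in _ - X]linearBl /= !(linearZl_LR, linearZr_LR) saa_mulxx.
    by rewrite !scaler0 subr0 [v ** a]mulNC scalerN opprK subrK.
  by move/mem_perp_mul: uk => uk; move/mem_perp_mul: vl => vl; exact: memvB.
apply/mul_vs_subP => u v /(subvP sP); rewrite -center_perp mem_transp memvf /=.
by move=> /mul_vs_subP H _; apply: H; rewrite ?memv_line ?memvf.
Qed.

Lemma dim_lcs6 : \dim (lcs L 6) = 3%N.
Proof.
have := lcs_strict (isT : 5 < 7)%N; rewrite dim_lcs7.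
have := dimvS (lcs_perp lcs8 (isT : 7 <= 2 + 5)%N).
by have := dim_perp (lcs L 3); rewrite dL dim_lcs3; lia.
Qed.

Lemma perp3 : perp (lcs L 3) = lcs L 6.
Proof.
apply/esym/eqP; rewrite eqEdim (lcs_perp lcs8 (isT : 7 <= 2 + 5)%N)/= dim_lcs6.
by have := dim_perp (lcs L 3); rewrite dL dim_lcs3; lia.
Qed.

Lemma perp2 : perp (lcs L 2) = lcs L 7.
Proof.
apply/esym/eqP; rewrite eqEdim (lcs_perp lcs8 (isT : 7 <= 1 + 6)%N)/= dim_lcs7.
by rewrite -center_perp dZ.
Qed.

Lemma mul52_neq0 u : u \in lcs L 5 ->
  (forall v, v \in lcs L 2 -> u ** v = 0) -> u \in lcs L 6.
Proof.
move=> uL u0; rewrite -perp3; apply/mem_perp_mul => v; apply/mem_perp => w wL.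
by rewrite triC23 u0// linear0l oppr0.
Qed.

Lemma dim_lcs5 : \dim (lcs L 5) = 4%N.
Proof.
have := lcs_strict (isT : 4 < 7)%N; have := lcs_strict (isT : 3 < 7)%N.
have := lcs_strict (isT : 2 < 7)%N; rewrite dim_lcs3 dim_lcs6.
have := dimvS (lcs_perp lcs8 (isT : 7 <= 3 + 4)%N).
by have := dim_perp (lcs L 4); rewrite dL; lia.
Qed.

Hypothesis W52 : (mul_vs (lcs L 5) (lcs L 2) <= mul_vs (lcs L 4) (lcs L 3))%VS.

(** The other possible dimension is 5.  Then L^4, spanned by its radical L^5 and one
    vector, would be isotropic, so that L^4 L^3 = 0; hence L^5 L^2 = 0, which forces
    L^5 into L^6. *)
Lemma dim_lcs4 : \dim (lcs L 4) = 6%N.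
Proof.
have := lcs_strict (isT : 3 < 7)%N; have := lcs_strict (isT : 2 < 7)%N.
rewrite dim_lcs3 dim_lcs5 => l7 l4; suff : \dim (lcs L 4) != 5%N by lia.
apply/negP => /eqP d4.
have [p pL p5] : exists2 p, p \in lcs L 4 & p \notin lcs L 5.
  by apply: dim_lt_pick; rewrite dim_lcs5 d4.
have dec := line_complement (lcs_sub _ 3) pL p5 (_ : _ <= _)%N.
have iso u v : u \in lcs L 4 -> v \in lcs L 4 -> (|u, v|) = 0.
  move=> uL vL; have [|k uk] := dec _ u uL; first by rewrite dim_lcs5 d4.
  have [|l vl] := dec _ v vL; first by rewrite dim_lcs5 d4.
  rewrite -[u](subrK (k *: p)) linearDl /= (form_lcs (isT : 7 <= 4 + 3)%N)// add0r.
  rewrite -[v](subrK (l *: p)) linearDr /= [X in X + _]form0C ?add0r.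
    by rewrite linearZl_LR linearZr_LR /= saa_formxx !mulr0.
  by rewrite (form_lcs (isT : 7 <= 4 + 3)%N)// memvZ.
have m43 : (mul_vs (lcs L 4) (lcs L 3) <= 0)%VS.
  apply/mul_vs_subP => u v uL vL; rewrite memv0; apply/eqP/saa_nondeg => w.
  by rewrite tri_form mulNC linearNr iso ?oppr0// lcsS mem_mul_vs ?memvf.
have [u uL] : exists2 u, u \in lcs L 5 & u \notin lcs L 6.
  by apply: dim_lt_pick; rewrite dim_lcs5 dim_lcs6.
move/negP; apply; apply: mul52_neq0 => // v vL; apply/eqP; rewrite -memv0.
by apply: (subvP (subv_trans W52 m43)); exact: mem_mul_vs.
Qed.

Lemma perp4 : perp (lcs L 4) = lcs L 5.
Proof.
apply/esym/eqP; rewrite eqEdim (lcs_perp lcs8 (isT : 7 <= 3 + 4)%N)/= dim_lcs5.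
by have := dim_perp (lcs L 4); rewrite dL dim_lcs4; lia.
Qed.

End Dims.

(** * Gram-Schmidt for hyperbolic pairs *)

Section Hyperbolic.
Variables (F : fieldType) (L : saa F).
Implicit Types (M U V W : {vspace L}) (u v w x y : L) (s : seq (L * L)).

Definition orth u (p : L * L) := (|u, p.1|) = 0 /\ (|u, p.2|) = 0.

Fixpoint orths u s := if s is p :: s' then orth u p /\ orths u s' else True.

Fixpoint hyper s := if s is p :: s' then
  [/\ (|p.1, p.2|) = 1, orths p.1 s', orths p.2 s' & hyper s'] else True.

Fixpoint inside M s := if s is p :: s' then
  [/\ p.1 \in M, p.2 \in M & inside M s'] else True.

Lemma orthsDZ k u v s : orths u s -> orths v s -> orths (u + k *: v) s.
Proof.
elim: s => //= p s IH [[u1 u2] us] [[v1 v2] vs]; split; last exact: IH.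
by split; rewrite linearDl linearZl_LR /= ?u1 ?v1 ?u2 ?v2 mulr0 addr0.
Qed.

(** Each pair (x, y) replaces v by v - (x, v) y + (y, v) x.  The last two conclusions
    keep track of what the correction preserves. *)
Lemma hyper_proj s v : hyper s -> exists v',
  [/\ orths v' s, forall w, orths w s -> (|w, v'|) = (|w, v|) &
      forall M, inside M s -> v' - v \in M].
Proof.
elim: s => [|[x y] s IH] /=.
  by exists v; split=> // M _; rewrite subrr mem0v.
move=> [xy xs ys /IH[v1 [v1s v1w v1M]]].
exists (v1 + (- (|x, v1|)) *: y + (|y, v1|) *: x); split.
- split; last by apply: orthsDZ => //; exact: orthsDZ.
  split; rewrite 2!linearDl !linearZl_LR /= saa_formxx.
    by rewrite [(|y, x|)]formNC xy [(|v1, x|)]formNC; ring.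
  by rewrite xy [(|v1, y|)]formNC; ring.
- move=> w [[wx wy] /v1w <-].
  by rewrite 2!linearDr !linearZr_LR /= wx wy !mulr0 !addr0.
move=> M [xM yM /v1M vM].
have -> : v1 + (- (|x, v1|)) *: y + (|y, v1|) *: x - v =
    (v1 - v) + ((- (|x, v1|)) *: y + (|y, v1|) *: x).
  by rewrite -!addrA; congr (_ + _); rewrite addrA addrC.
by apply: memvD => //; apply: memvD; exact: memvZ.
Qed.

Lemma hyper_extend s x v : hyper s -> orths x s -> (|x, v|) = 1 ->
  exists y, [/\ hyper ((x, y) :: s), forall w, orths w s -> (|w, y|) = (|w, v|) &
     forall M, inside M s -> y - v \in M].
Proof.
move=> hs xs xv; have [y [ys yw yM]] := hyper_proj v hs.
by exists y; split=> //=; split=> //; rewrite yw.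
Qed.

Lemma form_scale u v : (|u, v|) != 0 -> (|u, (|u, v|)^-1 *: v|) = 1.
Proof. by move=> uv; rewrite linearZr_LR /= mulVf. Qed.

End Hyperbolic.

(** * A basis running through the lower central series *)

Section Adapted.
Variables (F : fieldType) (L : saa F).
Implicit Types (M U V W : {vspace L}) (u v w x y : L).
Hypotheses (dL : \dim {:L} = 10%N) (c7 : has_class L 7).
Hypothesis dZ : \dim (center L) = 2%N.
Hypothesis W52 : (mul_vs (lcs L 5) (lcs L 2) <= mul_vs (lcs L 4) (lcs L 3))%VS.
Hypothesis W43 : mul_vs (lcs L 4) (lcs L 3) <> lcs L 7.

Let d2 := dim_lcs2 dL dZ.
Let d3 := dim_lcs3 dL c7 dZ.
Let d4 := dim_lcs4 dL c7 dZ W52.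
Let d5 := dim_lcs5 dL c7 dZ.
Let d6 := dim_lcs6 dL c7 dZ.
Let d7 := dim_lcs7 dL c7 dZ.

(** L^5 L^3 = L^6 L^2 = 0, so a product of L^5 and L^2 depends only on the classes
    of its factors modulo L^6 and L^3, and these quotients are lines. *)
Lemma mul52_line x y : x \in lcs L 5 -> x \notin lcs L 6 ->
    y \in lcs L 2 -> y \notin lcs L 3 ->
  [/\ x ** y != 0, x ** y \in lcs L 7 &
      forall u v, u \in lcs L 5 -> v \in lcs L 2 -> u ** v \in <[x ** y]>%VS].
Proof.
move=> xL x6 yL y3.
have decx u : u \in lcs L 5 -> exists k, u - k *: x \in lcs L 6.
  by move=> uL; apply: (line_complement (lcs_sub L 4) xL x6 _ uL); rewrite d5 d6.
have decy u : u \in lcs L 2 -> exists k, u - k *: y \in lcs L 3.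
  by move=> uL; apply: (line_complement (lcs_sub L 1) yL y3 _ uL); rewrite d2 d3.
have line u v : u \in lcs L 5 -> v \in lcs L 2 -> u ** v \in <[x ** y]>%VS.
  move=> uL vL; have [k uk] := decx u uL; have [l vl] := decy v vL.
  rewrite -[u](subrK (k *: x)) linearDl /=.
  rewrite [X in X + _](mul_lcs (i := 5) (j := 1) c7)// add0r.
  rewrite -[v](subrK (l *: y)) linearDr /=.
  rewrite [X in X + _](mul_lcs (i := 4) (j := 2) c7) ?memvZ// add0r.
  by rewrite linearZl_LR linearZr_LR /= !memvZ// memv_line.
split=> //.
  apply: contraNneq x6 => xy0; apply: (mul52_neq0 dL c7 dZ) => // v vL.
  by have /vlineP[k ->] := line x v xL vL; rewrite xy0 scaler0.
rewrite -(perp2 dL c7 dZ); apply/mem_perp => w wL; have [l wl] := decy w wL.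
rewrite -[w](subrK (l *: y)) linearDr /= linearZr_LR /=.
rewrite [(|_, y|)]saa_formC saa_mulxx linear0l mulr0 addr0 triC23.
by rewrite (mul_lcs (i := 4) (j := 2) c7) ?linear0l ?oppr0.
Qed.


(** The part of the basis that the multiplication determines; the vectors y_3, y_4
    and y_5 only have to complete it symplectically. *)
Lemma flag_low : exists x1 x2 x3 x4 x5 y1 y2 : L,
  [/\ [/\ x1 \in lcs L 4, x2 \in lcs L 5, x3 \in lcs L 6, x4 \in lcs L 7 &
          x5 \in lcs L 7],
      [/\ x5 != 0, x4 \notin <[x5]>%VS & x3 \notin lcs L 7],
      [/\ y1 \in lcs L 4, y2 \in lcs L 3 & x2 \notin lcs L 6],
      [/\ (|x1, y1|) = 1, (|x2, y2|) = 1, (|x1, y2|) = 0 & (|y1, y2|) = 0] &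
      [/\ x1 ** y2 = x5, y1 ** y2 = x3,
          (forall u v, u \in lcs L 5 -> v \in lcs L 2 -> u ** v \in <[x5]>%VS) &
          forall u, u \in lcs L 4 ->
            exists k l, u - k *: x1 - l *: y1 \in lcs L 5]].
Proof.
have [a aL a6] : exists2 a, a \in lcs L 5 & a \notin lcs L 6.
  by apply: dim_lt_pick; rewrite d5 d6.
have [b bL b4] : exists2 b, b \in lcs L 3 & b \notin lcs L 4.
  by apply: dim_lt_pick; rewrite d3 d4.
have [c cL c3] : exists2 c, c \in lcs L 2 & c \notin lcs L 3.
  by apply: dim_lt_pick; rewrite d2 d3.
have [ac0 acZ acl] := mul52_line aL a6 cL c3.
set x5 := a ** c in ac0 acZ acl *.
have decb u : u \in lcs L 3 -> exists k, u - k *: b \in lcs L 4.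
  by move=> uL; apply: (line_complement (lcs_sub L 2) bL b4 _ uL); rewrite d3 d4.
(* L^4 L^4 = 0, so L^4 multiplies L^3 through the class of b alone *)
have mulb u v : u \in lcs L 4 -> v \in lcs L 3 -> exists k, u ** v = k *: (u ** b).
  move=> uL vL; have [k vk] := decb v vL; exists k.
  rewrite -[v](subrK (k *: b)) linearDr /= linearZr_LR /=.
  by rewrite [X in X + _](mul_lcs c7 (i := 3) (j := 3))// add0r.
have [x1 x1L x1b] : exists2 x1, x1 \in lcs L 4 & x1 ** b = x5.
  have sW : (mul_vs (lcs L 4) (lcs L 3) <=
             linfun (applyr (saa_mul L) b) @: lcs L 4)%VS.
    apply/mul_vs_subP => u v uL vL; have [k ->] := mulb u v uL vL.
    by apply/memv_imgP; exists (k *: u); rewrite ?memvZ// lfunE /= linearZl_LR.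
  have /memv_imgP[x1 x1L ->] : x5 \in (linfun (applyr (saa_mul L) b) @: lcs L 4)%VS.
    by apply: (subvP sW); apply: (subvP W52); exact: mem_mul_vs.
  by exists x1; rewrite ?lfunE.
have x15 : x1 \notin lcs L 5.
  by apply: contraNN ac0 => x15; rewrite -x1b (mul_lcs c7 (i := 4) (j := 2)).
have [y1 y1L xy1] : exists2 y1, y1 \in lcs L 4 & (|x1, y1|) = 1.
  move: x15; rewrite -(perp4 dL c7 dZ W52) => /perpPn[y yL /form_scale yx].
  by exists ((|x1, y|)^-1 *: y); rewrite ?memvZ.
have dec4 u : u \in lcs L 4 -> exists k l, u - k *: x1 - l *: y1 \in lcs L 5.
  move=> uL; have s1 : (lcs L 5 + <[x1]> <= lcs L 4)%VS.
    by rewrite subv_add (lcs_sub L 3) -memvE.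
  have y1n : y1 \notin (lcs L 5 + <[x1]>)%VS.
    apply/negP => /memv_addP[l lL [_ /vlineP[k ->] yE]].
    move/eqP: xy1; rewrite yE linearDr linearZr_LR /= saa_formxx mulr0 addr0.
    by rewrite (form_lcs c7 (i := 3) (j := 4))// eq_sym oner_eq0.
  have [|l ul] := line_complement s1 y1L y1n _ uL; first by rewrite dim_add_line// d4 d5.
  have /memv_addP[z zL [_ /vlineP[k ->] zE]] := ul.
  by exists k, l; rewrite addrAC zE addrK.
pose x3 := y1 ** b.
have x3L : x3 \in lcs L 6.
  rewrite -(perp3 dL c7 dZ); apply/mem_perp => w wL; have [k wk] := decb w wL.
  rewrite -[w](subrK (k *: b)) linearDr /= linearZr_LR /=.
  rewrite [(|_, b|)]saa_formC saa_mulxx linear0l mulr0 addr0 triC23.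
  by rewrite (mul_lcs c7 (i := 3) (j := 3)) ?linear0l ?oppr0.
(* otherwise some y1 - k x1 annihilates L^3, so it is orthogonal to L^4, hence to x1 *)
have x3l : x3 \notin <[x5]>%VS.
  apply/negP => /vlineP[k x3E].
  have z0 : (y1 - k *: x1) ** b = 0.
    by rewrite linearBl linearZl_LR /= x1b -/x3 x3E subrr.
  have zL : y1 - k *: x1 \in lcs L 4 by rewrite memvB ?memvZ.
  have : y1 - k *: x1 \in perp (lcs L 4).
    apply/mem_perp_mul => v; apply/mem_perp => w wL.
    by have [l wl] := mulb _ _ zL wL; rewrite triC23 wl z0 scaler0 linear0l oppr0.
  move=> /mem_perp/(_ _ x1L)/form0C/eqP.
  by rewrite linearBr linearZr_LR /= saa_formxx mulr0 subr0 xy1 oner_eq0.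
(* otherwise L^4 L^3, spanned by x5 and x3, would be L^7 *)
have x37 : x3 \notin lcs L 7.
  apply/negP => x37; apply: W43; apply/eqP; rewrite eqEsubv; apply/andP; split.
    apply/mul_vs_subP => u v uL vL; have [k ->] := mulb u v uL vL; apply: memvZ.
    have [k1 [l1 ul]] := dec4 u uL.
    have -> : u = (u - k1 *: x1 - l1 *: y1) + l1 *: y1 + k1 *: x1 by rewrite !subrK.
    rewrite 2!linearDl /= !linearZl_LR /= x1b -/x3.
    by rewrite (mul_lcs c7 (i := 4) (j := 2))// add0r memvD ?memvZ.
  apply/subvP => w wL.
  have x5s : (<[x5]> <= lcs L 7)%VS by rewrite -memvE.
  have [|k] := line_complement x5s x37 x3l _ wL; first by rewrite d7 dim_vline ac0.
  move=> /vlineP[l /eqP]; rewrite subr_eq => /eqP->.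
  by apply: memvD; apply: memvZ; [apply: (subvP W52)|]; exact: mem_mul_vs.
have [x4 x4L x4l] : exists2 x4, x4 \in lcs L 7 & x4 \notin <[x5]>%VS.
  by apply: dim_lt_pick; rewrite d7 dim_vline; case: (_ != _).
have ab : (|b, a|) != 0.
  apply: contraNneq a6 => ab0; rewrite -(perp3 dL c7 dZ); apply/mem_perp => w wL.
  have [k wk] := decb w wL; rewrite -[w](subrK (k *: b)) linearDr /= linearZr_LR /=.
  by rewrite [(|a, b|)]form0C// mulr0 addr0 (form_lcs c7 (i := 4) (j := 3)).
have hy : hyper [:: (x1, y1)] by [].
have [y2 [[[y2x y2y] _] _ /(_ (lcs L 4)) y2M]] := hyper_proj b hy.
have {}y2M : y2 - b \in lcs L 4 by exact: y2M.
exists x1, ((- (|b, a|)^-1) *: a), x3, x4, x5, y1, y2.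
split=> //.
- by split=> //; rewrite memvZ.
- split=> //; first by rewrite -(subrK b y2) memvD// (subvP (lcs_sub L 2)).
  apply: contra a6 => /(memvZ (- (|b, a|))).
  by rewrite scalerA mulrNN mulfV// scale1r.
- split=> //; [|exact: form0C..].
  rewrite linearZl_LR /= -(subrK b y2) linearDr /=.
  rewrite [X in _ * (X + _)](form_lcs c7 (i := 4) (j := 3))//.
  by rewrite add0r [(|a, b|)]formNC mulrNN mulVf.
have mulE u : u \in lcs L 4 -> u ** y2 = u ** b.
  move=> uL; rewrite -(subrK b y2) linearDr /=.
  by rewrite [X in X + _](mul_lcs c7 (i := 3) (j := 3))// add0r.
by split=> //; rewrite mulE.
Qed.

End Adapted.

Definition flag_triples : seq triple := map (fst \o fst) transvections ++ table.

(** The triples whose vanishing comes from x_1 y_2 = x_5, y_1 y_2 = x_3 and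
    x_2 y_3 being a multiple of x_5. *)
Definition forced : seq triple :=
  [:: ('x_2, 'y_3, 'y_4); ('x_1, 'y_2, 'y_3); ('x_1, 'y_2, 'y_4);
      ('y_1, 'y_2, 'y_4); ('y_1, 'y_2, 'y_5)].

(** Two of the three levels add up to 8 or more, so that two of the vectors have
    product zero. *)
Definition deep (t : triple) :=
  [|| 8 <= level t.1.1 + level t.1.2, 8 <= level t.1.2 + level t.2 |
      8 <= level t.2 + level t.1.1]%N.

Lemma deep_or t : uniqt t -> ~~ listed flag_triples t ->
  listed forced t || deep t.
Proof.
have : all (fun g => all (fun h => all (fun k => let t := (g, h, k) in
    if deep t then true else if uniqt t then
    listed flag_triples t || listed forced t else true) gens) gens) gens.
  by vm_compute.
case: t => [[g h] k] H ut; move/allP/(_ g (mem_gens g))/allP/(_ h (mem_gens h)): H.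
move/allP/(_ k (mem_gens k)) => /=; case: deep; first by rewrite orbT.
by rewrite ut => /orP[->//|->].
Qed.

Section Adapted.
Variables (F : fieldType) (L : saa F).
Implicit Types (M U V W : {vspace L}) (u v w x y : L).
Hypotheses (dL : \dim {:L} = 10%N) (c7 : has_class L 7).
Hypothesis dZ : \dim (center L) = 2%N.
Hypothesis W52 : (mul_vs (lcs L 5) (lcs L 2) <= mul_vs (lcs L 4) (lcs L 3))%VS.
Hypothesis W43 : mul_vs (lcs L 4) (lcs L 3) <> lcs L 7.

(** The outcome of [flag_low] and Gram-Schmidt, with exactly the features that
    determine which structure constants vanish. *)
Definition flag_basis (e : gen -> L) :=
  [/\ standard_basis e, forall g, e g \in lcs L (level g),
      e 'x_3 \notin lcs L 7,
      e 'x_1 ** e 'y_2 = e 'x_5 /\ e 'y_1 ** e 'y_2 = e 'x_3 &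
      forall u v, u \in lcs L 5 -> v \in lcs L 2 -> u ** v \in <[e 'x_5]>%VS].

Lemma hyper5 (s : 'I_5 -> L * L) :
  hyper [:: s (@Ordinal 5 4 isT); s (@Ordinal 5 3 isT); s (@Ordinal 5 2 isT);
            s (@Ordinal 5 1 isT); s (@Ordinal 5 0 isT)] ->
  symplectic (fun g : gen => match g with inl i => (s i).1 | inr i => (s i).2 end).
Proof.
case=> /= e5 [[x43 x43'] [[x42 x42'] [[x41 x41'] [[x40 x40'] _]]]]
          [[y43 y43'] [[y42 y42'] [[y41 y41'] [[y40 y40'] _]]]].
case=> e4 [[x32 x32'] [[x31 x31'] [[x30 x30'] _]]]
          [[y32 y32'] [[y31 y31'] [[y30 y30'] _]]].
case=> e3 [[x21 x21'] [[x20 x20'] _]] [[y21 y21'] [[y20 y20'] _]].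
case=> e2 [[x10 x10'] _] [[y10 y10'] _] [e1 _ _ _].
have oE m p q : @Ordinal 5 m p = @Ordinal 5 m q by exact: val_inj.
split=> -[[|[|[|[|[|i]]]]] // p] [[|[|[|[|[|j]]]]] // q];
  rewrite ?(oE _ p isT) ?(oE _ q isT) ?saa_formxx //; exact: form0C.
Qed.

Lemma flag_basis_exists : exists e, flag_basis e.
Proof.
have [x1 [x2 [x3 [x4 [x5 [y1 [y2 [[x1L x2L x3L x4L x5L] [x50 x4l x37]
  [y1L y2L x26] [xy1 xy2 x1y2 y1y2] [x1m y1m ml dec]]]]]]]]] :=
  flag_low dL c7 dZ W52 W43.
have fo := form_lcs c7.
pose s2 := [:: (x2, y2); (x1, y1)].
have h2 : hyper s2.
  split=> //=; [|by split=> //; split; exact: form0C].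
  by do 2?split; apply: (fo 4 3).
have x3s : orths x3 s2.
  do 3?split => //=;
    first [by apply: (fo 5 4) | by apply: (fo 5 2) | by apply: (fo 5 3)].
have [b3 b3L xb3] : exists2 y, y \in lcs L 2 & (|x3, y|) = 1.
  move: x37; rewrite -(perp2 dL c7 dZ) => /perpPn[y yL /form_scale yx].
  by exists ((|x3, y|)^-1 *: y); rewrite ?memvZ.
have [y3 [h3 w3 M3]] := hyper_extend h2 x3s xb3.
have sub i j u : (i <= j)%N -> u \in lcs L j.+1 -> u \in lcs L i.+1.
  by move=> ij; apply: (subvP (lcs_le L ij)).
have y3L : y3 \in lcs L 2.
  rewrite -(subrK b3 y3) memvD// M3//=; split; [exact: (sub 1 4)|exact: (sub 1 2)|].
  by split=> //; exact: (sub 1 3).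
set s3 := (x3, y3) :: s2 in h3.
have zs u : u \in lcs L 7 -> orths u s3.
  move=> uL; do 4?split => //=; first [by apply: (fo 6 5) | by apply: (fo 6 1) |
    by apply: (fo 6 4) | by apply: (fo 6 2) | by apply: (fo 6 3)].
have [b4 x5b4 x4b4] : exists2 y, (|x5, y|) = 0 & (|x4, y|) = 1.
  move: x4l; rewrite -[<[x5]>%VS]perpK => /perpPn[y yL /form_scale yx].
  exists ((|x4, y|)^-1 *: y) => //; rewrite linearZr_LR /=.
  by move: yL => /mem_perp/(_ _ (memv_line x5))/form0C->; rewrite mulr0.
have [y4 [h4 w4 _]] := hyper_extend h3 (zs _ x4L) x4b4.
have x5s : orths x5 ((x4, y4) :: s3).
  split; last exact: zs.
  by split; [exact: (fo 6 6) | rewrite w4 //; exact: zs].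
have [b5 x5b5] : exists y, (|x5, y|) = 1.
  have : x5 \notin perp {:L}.
    by apply: contra x50 => /mem_perp x0; apply/eqP/saa_nondeg => v; rewrite x0 ?memvf.
  by move=> /perpPn[y _ /form_scale yx]; exists ((|x5, y|)^-1 *: y).
have [y5 [h5 _ _]] := hyper_extend h4 x5s x5b5.
pose s (i : 'I_5) :=
  nth (0, 0) [:: (x1, y1); (x2, y2); (x3, y3); (x4, y4); (x5, y5)] i.
exists (fun g : gen => match g with inl i => (s i).1 | inr i => (s i).2 end).
split=> //; first by apply: symp_basis => //; exact: hyper5.
by case=> [[[|[|[|[|[|i]]]]] // p]|[[|[|[|[|[|i]]]]] // p]] /=; rewrite ?memvf.
Qed.


Section FlagBasis.
Variable e : gen -> L.
Hypothesis fe : flag_basis e.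
Let se : standard_basis e. Proof. by case: fe. Qed.
Let sy := std_symp se.
Let eL g : e g \in lcs L (level g). Proof. by case: fe. Qed.

Lemma level_gt0 g : (0 < level g)%N.
Proof. by case: g => [[[|[|[|[|[|i]]]]] ?]|[[|[|[|[|[|i]]]]] ?]]. Qed.

Lemma mul_deep g h : (8 <= level g + level h)%N -> e g ** e h = 0.
Proof.
move=> gh; have := eL g; have := eL h; move: gh (level_gt0 g) (level_gt0 h).
case: (level g) (level h) => [|i] [|j]// ij _ _ hL gL.
by apply: (mul_lcs c7 (i := i) (j := j)) => //; rewrite addSn addnS in ij.
Qed.

Lemma tri_deep t : deep t -> tri e t = 0.
Proof.
case: t => [[g h] k]; rewrite /deep /tri /= => /or3P[] /mul_deep m0.
- by rewrite m0 linear0l.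
- by rewrite saa_formC m0 linear0l.
by rewrite saa_formC saa_formC m0 linear0l.
Qed.

Lemma tri_forced t : listed forced t -> tri e t = 0.
Proof.
have [_ _ _ [x1m y1m] ml] := fe.
case/hasP => t' + tt'; move=> t'f; apply: tri_perm tt' _; move: t'f; rewrite !inE.
have /vlineP[k kE] := ml _ _ (eL 'x_2) (eL 'y_3).
case/orP => [|]; last do ![case/orP]; move=> /eqP->; rewrite /tri /= ?x1m ?y1m ?kE.
- by rewrite linearZl_LR /= form_dual ?mulr0.
all: by apply: form_dual.
Qed.

Lemma flag_supported : supported e flag_triples.
Proof.
move=> t nt; have [ut|/tri_nuniq//] := boolP (uniqt t).
by have /orP[/tri_forced|/tri_deep] := deep_or ut nt.
Qed.

Lemma mul_eq0_std g h : (forall k, tri e (g, h, k) = 0) -> e g ** e h = 0.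
Proof. by move=> H; apply: (form0_std se) => k; exact: H. Qed.

Let exy i : (|e (inl i), e (inr i)|) = 1.
Proof. by have [_ _ ->] := sy; rewrite eqxx. Qed.

Lemma coor_lcs m u g : u \in lcs L m.+1 -> (level g <= m)%N -> coor e g u = 0.
Proof.
move=> uL gm; apply/coor_form; have := eL (dual g); have := level_dual g.
case: (level (dual g)) => [|j] gj.
  by move: gj; case: g gm => [[[|[|[|[|[|i]]]]] ?]|[[|[|[|[|[|i]]]]] ?]].
by apply: (form_lcs c7) uL; clear -gj gm; lia.
Qed.

Lemma tri_x2y3y5 : tri e ('x_2, 'y_3, 'y_5) != 0.
Proof.
have fo := form_lcs c7; have [_ _ _ _ ml] := fe.
have /mul52_line H : e 'x_2 \notin lcs L 6.
  apply/negP => x26; have /eqP := exy (@Ordinal 5 1 isT).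
  by rewrite (fo 5 2 _ _ isT x26 (eL 'y_2)) eq_sym oner_eq0.
have [|H1 _ _] := H dL c7 dZ _ (eL 'x_2) (eL 'y_3).
  apply/negP => y33; have /eqP := exy (@Ordinal 5 2 isT).
  by rewrite (fo 5 2 _ _ isT (eL 'x_3) y33) eq_sym oner_eq0.
have /vlineP[k kE] := ml _ _ (eL 'x_2) (eL 'y_3).
rewrite /tri /= kE linearZl_LR /= exy mulr1; apply: contraNneq H1 => k0.
by rewrite kE k0 scale0r.
Qed.

(** Every other value involving x_3 vanishes, and x_3 is not central. *)
Lemma tri_x3y4y5 : tri e ('x_3, 'y_4, 'y_5) != 0.
Proof.
have [_ _ + _ _] := fe; apply: contraNneq => T0.
rewrite -(perp2 dL c7 dZ); apply/mem_perp_mul => v.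
suff -> : e 'x_3 ** v = 0 by rewrite mem0v.
rewrite (coor_expand se v) linear_sumr big1// => h _; rewrite linearZr_LR /=.
rewrite mul_eq0_std ?scaler0// => k.
have : all (fun h => all (fun k =>
    listed flag_triples ('x_3, h, k) ==>
    permt ('x_3, h, k) ('x_3, 'y_4, 'y_5)) gens) gens by vm_compute.
move/allP/(_ h (mem_gens h))/allP/(_ k (mem_gens k))/implyP => hk.
by have [/hk/tri_perm->|/flag_supported] := boolP (listed flag_triples ('x_3, h, k)).
Qed.

(** If the value vanished, x_1 y_3 would be a multiple of x_5.  The elements of U have
    no component along y_1, since y_1 y_2 = x_3 is not a multiple of x_5; so U L^2
    would be contained in the line of x_5. *)
Lemma tri_x1y3y4 (U := transp (lcs L 4) (lcs L 3) (mul_vs (lcs L 5) (lcs L 2))) :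
  \dim (mul_vs U (lcs L 2)) = 2%N -> tri e ('x_1, 'y_3, 'y_4) != 0.
Proof.
have [_ _ x37 [x1m y1m] ml] := fe.
move=> dU; apply/eqP => T0.
suff /dimvS : (mul_vs U (lcs L 2) <= <[e 'x_5]>)%VS.
  by rewrite dU dim_vline; case: (_ != _).
have x1y3 : e 'x_1 ** e 'y_3 \in <[e 'x_5]>%VS.
  apply/vlineP; exists (tri e ('x_1, 'y_3, 'y_5)).
  apply/eqP; rewrite -subr_eq0; apply/eqP/(form0_std se) => k.
  rewrite linearBl linearZl_LR /=.
  have [->|k5] := eqVneq k 'y_5; first by rewrite exy mulr1 subrr.
  rewrite [(|e 'x_5, _|)]form_dual// mulr0 subr0.
  have [->//|k4] := eqVneq k 'y_4.
  apply: (flag_supported (t := ('x_1, 'y_3, k))).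
  have : all (fun k => listed flag_triples ('x_1, 'y_3, k) ==>
    ((k == 'y_4) || (k == 'y_5))) gens by vm_compute.
  by move/allP/(_ k (mem_gens k)); rewrite (negPf k4) (negPf k5) implybF.
have x1v v : v \in lcs L 2 -> e 'x_1 ** v \in <[e 'x_5]>%VS.
  move=> vL; rewrite (coor_expand se v) linear_sumr memv_suml// => h _.
  rewrite linearZr_LR /=; have [h4|h4] := leqP 4 (level h).
    by rewrite mul_deep ?scaler0 ?mem0v// (leq_add (_ : 4 <= level 'x_1)%N).
  have [h1|h1] := leqP (level h) 1; first by rewrite (coor_lcs vL h1) scale0r mem0v.
  apply: memvZ; have := gensP (P := fun h => (2 <= level h < 4)%N ==>
    ((h == 'y_2) || (h == 'y_3))) h; rewrite h4 h1 => /(_ isT)/orP[]/eqP->//.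
  by rewrite x1m memv_line.
apply/mul_vs_subP => u v; rewrite mem_transp => /andP[uL /mul_vs_subP uV] vL.
have y1u : coor e 'y_1 u = 0.
  have : (|u ** e 'y_2, e 'y_3|) = 0.
    have /subvP H : (mul_vs (lcs L 5) (lcs L 2) <= <[e 'x_5]>)%VS.
      by apply/mul_vs_subP.
    have /H/vlineP[k ->] := uV _ _ (memv_line u) (eL 'y_2).
    by rewrite linearZl_LR /= form_dual ?mulr0.
  rewrite {1}(coor_expand se u) linear_sumlz linear_sumlz (bigD1 'y_1)//= big1 ?addr0.
    by rewrite !linearZl_LR /= y1m exy mulr1.
  move=> g gy1; rewrite !linearZl_LR /=.
  have [g3|g3] := leqP (level g) 3; first by rewrite (coor_lcs uL g3) mul0r.
  rewrite -[(|_, _|)]/(tri e (g, 'y_2, 'y_3)) flag_supported ?mulr0//.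
  have := gensP (P := fun g => (3 < level g)%N && (g != 'y_1) ==>
    ~~ listed flag_triples (g, 'y_2, 'y_3)) g.
  by rewrite g3 gy1; apply; vm_compute.
rewrite (coor_expand se u) linear_sumlz memv_suml// => g _.
rewrite linearZl_LR /=; have [g3|g3] := leqP (level g) 3.
  by rewrite (coor_lcs uL g3) scale0r mem0v.
have [g5|g5] := leqP 5 (level g).
  apply/memvZ/ml => //; have := lcs_le L (_ : 4 <= (level g).-1)%N.
  move=> /(_ _)/subvP; apply; first by rewrite -ltnS (ltn_predK g5).
  by rewrite (ltn_predK g5).
have := gensP (P := fun g => (3 < level g < 5)%N ==> ((g == 'x_1) || (g == 'y_1))) g.
rewrite g3 g5 => /(_ isT)/orP[]/eqP->; first by apply: memvZ; exact: x1v.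
by rewrite y1u scale0r mem0v.
Qed.

Lemma flag_neq0 (U := transp (lcs L 4) (lcs L 3) (mul_vs (lcs L 5) (lcs L 2))) :
  \dim (mul_vs U (lcs L 2)) = 2%N -> forall t, listed table t -> tri e t != 0.
Proof.
move=> dU t /hasP[t' + /(tri_sign F)[b tb]]; rewrite {}tb => t'K.
rewrite mulf_neq0 ?signr_eq0//.
have [_ _ _ [x1m y1m] _] := fe.
move: t'K; rewrite !inE; case/orP => [|]; last do ![case/orP]; move=> /eqP->.
- exact: tri_x2y3y5.
- exact: tri_x3y4y5.
- by rewrite /tri /= x1m exy oner_eq0.
- exact: tri_x1y3y4.
by rewrite /tri /= y1m exy oner_eq0.
Qed.

End FlagBasis.
End Adapted.

Unset Implicit Arguments.

Theorem proposition8p9 (F : fieldType) :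
  (forall L : saa F,
     \dim {:L} = 10%N ->
     nilpotent L ->
     isotropic (center L) ->
     \dim (center L) = 2%N ->
     has_class L 7 ->
     mul_vs (lcs L 4) (lcs L 3) <> lcs L 7 ->
     (mul_vs (lcs L 5) (lcs L 2) <= mul_vs (lcs L 4) (lcs L 3))%VS ->
     let U := transp (lcs L 4) (lcs L 3) (mul_vs (lcs L 5) (lcs L 2)) in
     \dim (mul_vs U (lcs L 2)) = 2%N ->
     exists r : F, r != 0 /\ given_by L (P10_2_6 r)) /\
  (forall r s : F, r != 0 -> s != 0 ->
     forall A B : saa F, given_by A (P10_2_6 r) -> given_by B (P10_2_6 s) ->
     (saa_isom A B <-> exists2 a : F, a != 0 & s / r = a ^+ 12)).
Proof.
split=> [L dL _ _ dZ c7 W43 W52 U dU|r s r0 s0 A B]; last exact: presentations_isom.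
have [e fe] := flag_basis_exists dL c7 dZ W52 W43.
have [se _ _ _ _] := fe.
have [e1 [se1 eS1 nz1]] := kill_all transvections_ok dL se (flag_supported c7 fe)
  (flag_neq0 dL c7 dZ fe dU).
have [r [e2 [r0 ne2]]] := normalize se1 eS1 nz1.
by exists r; split=> //; apply/given_byP; exists e2.
Qed.
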